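(* The following assertions are equivalent: (1) there exists a homogeneous, isometric Hopf algebra isomorphism between $\mathcal{H}_{\mathcal{PP}}$ and $\mathcal{H}_{\mathcal{SPP}}$; (2) the characteristic of the base field $\mathbb{K}$ is not $2$ and there exists $i\in\mathbb{K}$ such that $i^2=-1$.
   Context: $\mathbb{K}$ is a commutative field. A double poset is a finite set with two partial orders $(P,\leq_1,\leq_2)$, considered up to isomorphism (bijections preserving and reflecting both orders); subsets are double posets by restriction. $\mathcal{H}_{\mathcal{DP}}$ is the $\mathbb{K}$-vector space with basis the isoclasses of double posets, graded by cardinality. It is a graded connected Hopf algebra with the following structure. The product $PQ$ is the disjoint union of $P$ and $Q$, with $P,Q$ as double subposets, $x\leq_2 y$ for all $x\in P,y\in Q$, and no element of $P$ being $\leq_1$-comparable with an element of $Q$. The unit is the empty poset. The coproduct is $\Delta(P)=\sum_I (P\setminus I)\otimes I$, over subsets $I\subseteq P$ such that $x\in I$, $x\leq_1 y$ imply $y\in I$. It carries the symmetric Hopf pairing for which $\langle P,Q\rangle$ is the number of bijections $\sigma:P\to Q$ such that, for all $i,j\in P$: ($i\leq_1 j$ in $P$) implies ($\sigma(i)\leq_2\sigma(j)$ in $Q$), and ($\sigma(i)\leq_1\sigma(j)$ in $Q$) implies ($i\leq_2 j$ in $P$). A plane poset is a double poset $(P,\leq_h,\leq_r)$ (with $\leq_1=\leq_h$, $\leq_2=\leq_r$) such that two distinct elements are comparable for $\leq_h$ if and only if they are not comparable for $\leq_r$. Then the relation $x\leq y$ iff ($x\leq_h y$ or $x\leq_r y$)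 is a total order on $P$, and $(P,\leq_h,\leq)$ (with $\leq_1=\leq_h$, $\leq_2=\leq$) is called a special plane poset. $\mathcal{H}_{\mathcal{PP}}$ (resp. $\mathcal{H}_{\mathcal{SPP}}$) is the span in $\mathcal{H}_{\mathcal{DP}}$ of all plane posets (resp. special plane posets); both are graded Hopf subalgebras, each equipped with the restriction of $\langle-,-\rangle$. A linear map $\phi$ is isometric if $\langle\phi(x),\phi(y)\rangle=\langle x,y\rangle$ for all $x,y$, and homogeneous if it preserves the degree. *)

(* Defs.v *)
From HB Require Import structures.
From mathcomp Require Import all_boot all_order all_algebra finmap.
From mathcomp.multinomials Require Import monalg.

Set Implicit Arguments.
Unset Strict Implicit.
Unset Printing Implicit Defensive.

Import GRing.Theory.
Local Open Scope quotient_scope.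
Local Open Scope ring_scope.

(** * Double posets *)

Definition porderb (T : finType) (r : rel T) : bool :=
  [&& [forall x, r x x],
      [forall x, forall y, r x y && r y x ==> (x == y)] &
      [forall x, forall y, forall z, r x y && r y z ==> r x z]].

Lemma porderbP (T : finType) (r : rel T) :
  reflect [/\ reflexive r, antisymmetric r & transitive r] (porderb r).
Proof.
apply: (iffP and3P) => -[h1 h2 h3]; split.
- by move=> x; move/forallP: h1.
- by move=> x y; move/forallP: h2 => /(_ x)/forallP/(_ y)/implyP h /h/eqP.
- move=> y x z xy yz; move/forallP: h3 => /(_ x)/forallP/(_ y)/forallP/(_ z).
  by rewrite xy yz.
- exact/forallP.
- by apply/forallP=> x; apply/forallP=> y; apply/implyP=> /h2->.
- apply/forallP=> x; apply/forallP=> y; apply/forallP=> z.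
  by apply/implyP=> /andP[]; apply: h3.
Qed.

(** The two orders are stored as sets of pairs, so that [dposet T] is a
    [finType]. *)
Definition dposetb (T : finType) (r : {set T * T} * {set T * T}) : bool :=
  porderb (fun x y => (x, y) \in r.1) && porderb (fun x y => (x, y) \in r.2).

Record dposet (T : finType) := DPoset {
  dprel : {set T * T} * {set T * T};
  _ : dposetb dprel
}.

HB.instance Definition _ (T : finType) := [isSub for @dprel T].
HB.instance Definition _ (T : finType) := [Finite of dposet T by <:].

Definition le1 (T : finType) (P : dposet T) : rel T :=
  fun x y => (x, y) \in (dprel P).1.
Definition le2 (T : finType) (P : dposet T) : rel T :=
  fun x y => (x, y) \in (dprel P).2.

Lemma le1_porder (T : finType) (P : dposet T) : porderb (le1 P).
Proof. by case: P => r; rewrite /le1 /= => /andP[]. Qed.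

Lemma le2_porder (T : finType) (P : dposet T) : porderb (le2 P).
Proof. by case: P => r; rewrite /le2 /= => /andP[]. Qed.

Section MkDPoset.
Variables (T : finType) (r1 r2 : rel T).
Hypotheses (r1P : porderb r1) (r2P : porderb r2).

Lemma mkdposet_subproof :
  dposetb ([set p | r1 p.1 p.2], [set p | r2 p.1 p.2]).
Proof.
have e (r r' : rel T) : r =2 r' -> porderb r -> porderb r'.
  move=> err /porderbP[rr ra rt]; apply/porderbP; split=> [x|x y|y x z].
  - by rewrite -err.
  - by rewrite -!err; apply: ra.
  - by rewrite -!err; apply: rt.
by apply/andP; split; [apply: e r1P | apply: e r2P] => x y; rewrite inE.
Qed.

Definition mkdposet : dposet T := DPoset mkdposet_subproof.

Lemma le1_mk : le1 mkdposet =2 r1. Proof. by move=> x y; rewrite /le1 inE. Qed.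
Lemma le2_mk : le2 mkdposet =2 r2. Proof. by move=> x y; rewrite /le2 inE. Qed.

End MkDPoset.

Definition bijectiveb (T U : finType) (f : {ffun T -> U}) : bool :=
  injectiveb f && [forall y, y \in codom f].

Lemma bijectivebP (T U : finType) (f : {ffun T -> U}) :
  reflect (bijective f) (bijectiveb f).
Proof.
apply: (iffP andP) => [[/injectiveP fi /forallP fs]|[g fK gK]].
  by exists (fun y => iinv (fs y)) => x; rewrite ?f_iinv //; apply: fi; rewrite f_iinv.
split; first exact/injectiveP/can_inj/fK.
by apply/forallP=> y; apply/codomP; exists (g y); rewrite gK.
Qed.

Definition dpmorphb (T U : finType) (P : dposet T) (Q : dposet U)
    (f : T -> U) : bool :=
  [forall x, forall y, (le1 Q (f x) (f y) == le1 P x y) &&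
                       (le2 Q (f x) (f y) == le2 P x y)].

Definition diso (T U : finType) (P : dposet T) (Q : dposet U) : bool :=
  [exists f : {ffun T -> U}, bijectiveb f && dpmorphb P Q f].

Lemma disoP (T U : finType) (P : dposet T) (Q : dposet U) :
  reflect (exists f : T -> U, [/\ bijective f,
             forall x y, le1 Q (f x) (f y) = le1 P x y &
             forall x y, le2 Q (f x) (f y) = le2 P x y])
          (diso P Q).
Proof.
apply: (iffP existsP) => [[f /andP[/bijectivebP fb /forallP fm]]|[f [fb f1 f2]]].
  by exists f; split=> // x y; have /forallP/(_ y)/andP[/eqP ? /eqP ?] := fm x.
exists [ffun x => f x]; apply/andP; split.
  by apply/bijectivebP/(eq_bij fb) => x; rewrite ffunE.
by apply/forallP=> x; apply/forallP=> y; rewrite !ffunE f1 f2 !eqxx.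
Qed.

Lemma diso_refl (T : finType) (P : dposet T) : diso P P.
Proof. by apply/disoP; exists id; split=> //; exists id. Qed.

Lemma diso_sym (T U : finType) (P : dposet T) (Q : dposet U) :
  diso P Q = diso Q P.
Proof.
suff h (A B : finType) (P' : dposet A) (Q' : dposet B) : diso P' Q' -> diso Q' P'.
  by apply/idP/idP; apply: h.
move=> /disoP[f [[g fK gK] f1 f2]]; apply/disoP; exists g; split.
- by exists f.
- by move=> x y; rewrite -f1 !gK.
- by move=> x y; rewrite -f2 !gK.
Qed.

Lemma diso_trans (T U V : finType) (P : dposet T) (Q : dposet U) (S : dposet V) :
  diso P Q -> diso Q S -> diso P S.
Proof.
move=> /disoP[f [fb f1 f2]] /disoP[g [gb g1 g2]]; apply/disoP.
exists (g \o f); split; first exact: bij_comp.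
  by move=> x y; rewrite /= g1 f1.
by move=> x y; rewrite /= g2 f2.
Qed.

(** Double poset structure induced along an injection; for [val] this is the
    restriction to a subset. *)
Section Pull.
Variables (T U : finType) (f : U -> T) (fI : injective f) (P : dposet T).

Lemma pull_subproof (r : rel T) :
  porderb r -> porderb (fun x y : U => r (f x) (f y)).
Proof.
move=> /porderbP[rr ra rt]; apply/porderbP; split=> [x|x y h|y x z].
- exact: rr.
- exact/fI/ra.
- exact: rt.
Qed.

Definition dppull : dposet U :=
  mkdposet (pull_subproof (le1_porder P)) (pull_subproof (le2_porder P)).

Lemma le1_pull x y : le1 dppull x y = le1 P (f x) (f y).
Proof. exact: le1_mk. Qed.
Lemma le2_pull x y : le2 dppull x y = le2 P (f x) (f y).
Proof. exact: le2_mk. Qed.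

Lemma diso_pull : bijective f -> diso dppull P.
Proof.
move=> fb; apply/disoP; exists f; split=> // x y.
  by rewrite le1_pull.
by rewrite le2_pull.
Qed.

End Pull.

Definition dpsub (T : finType) (P : dposet T) (I : {set T}) :
  dposet {x : T | x \in I} := dppull val_inj P.

Section Product.
Variables (T U : finType) (P : dposet T) (Q : dposet U).

Definition dpmul_le1 (x y : T + U) : bool :=
  match x, y with
  | inl a, inl b => le1 P a b
  | inr a, inr b => le1 Q a b
  | _, _ => false
  end.

Definition dpmul_le2 (x y : T + U) : bool :=
  match x, y with
  | inl a, inl b => le2 P a b
  | inr a, inr b => le2 Q a b
  | inl _, inr _ => true
  | inr _, inl _ => false
  end.

Lemma dpmul_le1_porder : porderb dpmul_le1.
Proof.
have /porderbP[Pr Pa Pt] := le1_porder P.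
have /porderbP[Qr Qa Qt] := le1_porder Q.
apply/porderbP; split=> [[x|x]|[x|x] [y|y]|[y|y] [x|x] [z|z]] //=.
- by move=> /Pa->.
- by move=> /Qa->.
- exact: Pt.
- exact: Qt.
Qed.

Lemma dpmul_le2_porder : porderb dpmul_le2.
Proof.
have /porderbP[Pr Pa Pt] := le2_porder P.
have /porderbP[Qr Qa Qt] := le2_porder Q.
apply/porderbP; split=> [[x|x]|[x|x] [y|y]|[y|y] [x|x] [z|z]] //=.
- by move=> /Pa->.
- by move=> /Qa->.
- exact: Pt.
- exact: Qt.
Qed.

Definition dpmul : dposet (T + U)%type :=
  mkdposet dpmul_le1_porder dpmul_le2_porder.

Lemma le1_mul : le1 dpmul =2 dpmul_le1. Proof. exact: le1_mk. Qed.
Lemma le2_mul : le2 dpmul =2 dpmul_le2. Proof. exact: le2_mk. Qed.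

End Product.

Lemma porderb_void : porderb (fun _ _ : void => false).
Proof. by apply/porderbP; split=> -[]. Qed.

Definition dpempty : dposet void := mkdposet porderb_void porderb_void.

(** * Isoclasses of double posets *)

Definition fdposet := {n : nat & dposet 'I_n}.
HB.instance Definition _ := Choice.on fdposet.

Definition fdiso (P Q : fdposet) : bool := diso (tagged P) (tagged Q).

Lemma fdiso_equiv : equiv_class_of fdiso.
Proof.
split=> [P|P Q|P Q S]; [exact: diso_refl|exact: diso_sym|exact: diso_trans].
Qed.
Canonical fdiso_equiv_rel := EquivRelPack fdiso_equiv.

Definition isoclass : Type := {eq_quot fdiso}.

(** The [eqType] and [choiceType] structures are kept opaque: unfolding them
    makes unification diverge on terms of [{malg K[isoclass]}]. *)
Fact isoclass_hasDecEq : hasDecEq isoclass.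
Proof. exact: (Equality.eqtype_hasDecEq_mixin (Equality.class {eq_quot fdiso})). Qed.
HB.instance Definition _ := isoclass_hasDecEq.

Fact isoclass_hasChoice : hasChoice isoclass.
Proof. exact: (Choice.choice_hasChoice_mixin (Choice.class {eq_quot fdiso})). Qed.
HB.instance Definition _ := isoclass_hasChoice.

Definition frep (x : isoclass) : fdposet := repr (x : {eq_quot fdiso}).

Definition crd (x : isoclass) : nat := tag (frep x).
Definition rep (x : isoclass) : dposet 'I_(crd x) := tagged (frep x).

Definition cls (T : finType) (P : dposet T) : isoclass :=
  \pi_({eq_quot fdiso}) (Tagged (fun n => dposet 'I_n) (dppull (@enum_val_inj _ T) P)).

Lemma diso_enum (T : finType) (P : dposet T) :
  diso (dppull (@enum_val_inj _ T) P) P.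
Proof. exact/diso_pull/enum_val_bij. Qed.

Lemma clsP (T U : finType) (P : dposet T) (Q : dposet U) :
  reflect (cls P = cls Q) (diso P Q).
Proof.
have -> : diso P Q =
    fdiso (Tagged (fun n => dposet 'I_n) (dppull (@enum_val_inj _ T) P))
          (Tagged (fun n => dposet 'I_n) (dppull (@enum_val_inj _ U) Q)).
  have eP := diso_enum P; have eQ := diso_enum Q.
  apply/idP/idP; rewrite /fdiso /= => h.
    by apply: diso_trans eP (diso_trans h _); rewrite diso_sym.
  by apply: diso_trans (diso_trans h eQ); rewrite diso_sym.
by apply: (iffP idP) => /(@eqquotP _ _ {eq_quot fdiso}).
Qed.

Lemma repK (x : isoclass) : cls (rep x) = x.
Proof.
rewrite -[RHS](@reprK _ {eq_quot fdiso}); apply/(@eqquotP _ _ {eq_quot fdiso}); rewrite /= /fdiso /=.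
exact: diso_enum.
Qed.

Lemma diso_rep (T : finType) (P : dposet T) : diso (rep (cls P)) P.
Proof. by apply/clsP; rewrite repK. Qed.

Lemma crd_cls (T : finType) (P : dposet T) : crd (cls P) = #|T|.
Proof.
by have /disoP[f [/bij_eq_card]] := diso_rep P; rewrite card_ord.
Qed.

Definition cmul (x y : isoclass) : isoclass := cls (dpmul (rep x) (rep y)).
Definition cone : isoclass := cls dpempty.

Lemma diso_mul (T T' U U' : finType) (P : dposet T) (P' : dposet T')
    (Q : dposet U) (Q' : dposet U') :
  diso P P' -> diso Q Q' -> diso (dpmul P Q) (dpmul P' Q').
Proof.
move=> /disoP[f [[f' fK f'K] f1 f2]] /disoP[g [[g' gK g'K] g1 g2]].
pose h (A A' B B' : Type) (u : A -> A') (v : B -> B') (x : A + B) : A' + B' :=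
  match x with inl a => inl (u a) | inr b => inr (v b) end.
apply/disoP; exists (h _ _ _ _ f g); split.
- by exists (h _ _ _ _ f' g') => -[x|x] /=; rewrite ?fK ?gK ?f'K ?g'K.
- by move=> [x|x] [y|y]; rewrite !le1_mul //= ?f1 ?g1.
- by move=> [x|x] [y|y]; rewrite !le2_mul //= ?f2 ?g2.
Qed.

Lemma cmul_cls (T U : finType) (P : dposet T) (Q : dposet U) :
  cmul (cls P) (cls Q) = cls (dpmul P Q).
Proof. by apply/clsP/diso_mul; apply: diso_rep. Qed.

Lemma cmulA : associative cmul.
Proof.
move=> x y z; rewrite -(repK x) -(repK y) -(repK z) !cmul_cls.
apply/clsP/disoP.
exists (fun u => match u with
  | inl a => inl (inl a) | inr (inl b) => inl (inr b) | inr (inr c) => inr c end).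
split.
- exists (fun u => match u with
    | inl (inl a) => inl a | inl (inr b) => inr (inl b) | inr c => inr (inr c) end).
    by case=> [|[]].
  by case=> [[]|].
- by move=> [u|[u|u]] [v|[v|v]]; rewrite !le1_mul /= ?le1_mul.
- by move=> [u|[u|u]] [v|[v|v]]; rewrite !le2_mul /= ?le2_mul.
Qed.

Lemma cmul1x : left_id cone cmul.
Proof.
move=> x; rewrite -(repK x) cmul_cls; apply/clsP; rewrite diso_sym.
apply/disoP; exists inr; split.
- by exists (fun u => match u with inl a => of_void _ a | inr b => b end) => // -[].
- by move=> u v; rewrite le1_mul.
- by move=> u v; rewrite le2_mul.
Qed.

Lemma cmulx1 : right_id cone cmul.
Proof.
move=> x; rewrite -(repK x) cmul_cls; apply/clsP; rewrite diso_sym.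
apply/disoP; exists inl; split.
- by exists (fun u => match u with inr a => of_void _ a | inl b => b end) => // -[].
- by move=> u v; rewrite le1_mul.
- by move=> u v; rewrite le2_mul.
Qed.

Lemma crd_mul x y : crd (cmul x y) = (crd x + crd y)%N.
Proof. by rewrite crd_cls card_sum !card_ord. Qed.

Lemma crd_eq0 x : crd x = 0%N -> x = cone.
Proof.
move=> x0; rewrite -(repK x); apply/clsP/disoP.
have F (i : 'I_(crd x)) : void by case: i => m; rewrite x0.
exists F; split; [| by move=> i; case: (F i) | by move=> i; case: (F i)].
by exists (of_void _) => i; [case: (F i) | case: i].
Qed.

Lemma cmul_unit x y : cmul x y = cone -> x = cone /\ y = cone.
Proof.
move=> /(congr1 crd); rewrite crd_mul crd_cls card_void => /eqP.
by rewrite addn_eq0 => /andP[/eqP/crd_eq0-> /eqP/crd_eq0->].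
Qed.

HB.instance Definition _ := Choice_isMonomialDef.Build isoclass
  cmulA cmul1x cmulx1 cmul_unit.

(** * The Hopf algebra of double posets *)

(** The algebra structure is the one of monoid algebras: the product extends
    [cmul] bilinearly, and the unit is the class of the empty double poset. *)
Notation HDP K := {malg K[isoclass]}.

(** [H ⊗ H], identified with the free module over pairs of isoclasses. *)
Notation HDP2 K := {malg K[(isoclass * isoclass)%type]}.

Definition tens (K : fieldType) (a b : HDP K) : HDP2 K :=
  \sum_(p <- msupp a) \sum_(q <- msupp b) << a@_p * b@_q *g (p, q) >>.

Definition upset (T : finType) (P : dposet T) (I : {set T}) : bool :=
  [forall x, forall y, (x \in I) && le1 P x y ==> (y \in I)].

Definition dpcoprod (K : fieldType) (T : finType) (P : dposet T) : HDP2 K :=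
  \sum_(I : {set T} | upset P I) << (cls (dpsub P (~: I)), cls (dpsub P I)) >>.

Definition coprod (K : fieldType) (a : HDP K) : HDP2 K :=
  \sum_(p <- msupp a) a@_p *: dpcoprod K (rep p).

Definition counit (K : fieldType) (a : HDP K) : K := a@_cone.

Definition pictureb (T U : finType) (P : dposet T) (Q : dposet U)
    (f : T -> U) : bool :=
  [forall i, forall j, (le1 P i j ==> le2 Q (f i) (f j)) &&
                       (le1 Q (f i) (f j) ==> le2 P i j)].

Definition npictures (T U : finType) (P : dposet T) (Q : dposet U) : nat :=
  #|[set f : {ffun T -> U} | bijectiveb f && pictureb P Q f]|.

Definition pairing (K : fieldType) (a b : HDP K) : K :=
  \sum_(p <- msupp a) \sum_(q <- msupp b)
     a@_p * b@_q * (npictures (rep p) (rep q))%:R.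

Definition homog (K : fieldType) (n : nat) (a : HDP K) : bool :=
  all (fun p => crd p == n) (msupp a).

(** The structure maps on the class of an arbitrary double poset, independently
    of the chosen representatives. *)
Lemma mulU (K : fieldType) (T U : finType) (P : dposet T) (Q : dposet U) :
  << cls P >> * << cls Q >> = << cls (dpmul P Q) >> :> HDP K.
Proof. by rewrite malgM_def fgmulUU mulr1 -cmul_cls. Qed.

Lemma npictures_diso (T T' U U' : finType) (P : dposet T) (P' : dposet T')
    (Q : dposet U) (Q' : dposet U') :
  diso P P' -> diso Q Q' -> npictures P Q = npictures P' Q'.
Proof.
suff h (A A' B B' : finType) (R : dposet A) (R' : dposet A')
    (S : dposet B) (S' : dposet B') :
    diso R R' -> diso S S' -> (npictures R S <= npictures R' S')%N.
  by move=> eP eQ; apply/eqP; rewrite eqn_leq !h // diso_sym.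
move=> /disoP[f [[f' fK f'K] f1 f2]] /disoP[g [[g' gK g'K] g1 g2]].
pose F (u : {ffun A -> B}) := [ffun x => g (u (f' x))].
have FI : injective F.
  move=> u v /ffunP e; apply/ffunP=> x.
  by have := e (f x); rewrite !ffunE fK => /(can_inj gK).
rewrite /npictures -(card_imset _ FI); apply/subset_leq_card/subsetP=> _ /imsetP[u + ->].
rewrite !inE => /andP[/bijectivebP ub /forallP up]; apply/andP; split.
  apply/bijectivebP/(@eq_bij _ _ (g \o u \o f')); last by move=> x; rewrite ffunE.
  by apply: bij_comp; [apply: bij_comp => //; exists g' | exists f].
apply/forallP=> i; apply/forallP=> j; rewrite !ffunE g1 g2.
by have /forallP/(_ (f' j)) := up (f' i); rewrite -f1 -f2 !f'K.
Qed.

Lemma pairingU (K : fieldType) (T U : finType) (P : dposet T) (Q : dposet U) :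
  pairing << cls P >> << cls Q >> = (npictures P Q)%:R :> K.
Proof.
rewrite /pairing !msuppU oner_eq0 !big_seq_fset1 !mcoeffUU !mul1r.
by rewrite (npictures_diso (diso_rep P) (diso_rep Q)).
Qed.

Lemma dpcoprod_diso (K : fieldType) (T U : finType) (P : dposet T) (Q : dposet U) :
  diso P Q -> dpcoprod K P = dpcoprod K Q.
Proof.
move=> /disoP[f [[g fK gK] f1 f2]].
have sub (I : {set U}) : diso (dpsub P (f @^-1: I)) (dpsub Q I).
  have hf (x : {x | x \in f @^-1: I}) : f (val x) \in I by have := valP x; rewrite inE.
  have hg (y : {y | y \in I}) : g (val y) \in f @^-1: I by rewrite inE gK (valP y).
  apply/disoP; exists (fun x => Sub (f (val x)) (hf x)); split.
  - by exists (fun y => Sub (g (val y)) (hg y)) => x; apply: val_inj; rewrite /= ?fK ?gK.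
  - by move=> x y; rewrite !le1_pull f1.
  - by move=> x y; rewrite !le2_pull f2.
rewrite /dpcoprod (reindex (fun I : {set U} => f @^-1: I)) /=; last first.
  exists (fun I : {set T} => g @^-1: I) => I _; apply/setP=> x.
    by rewrite !inE gK.
  by rewrite !inE fK.
apply: eq_big => [I|I _].
  apply/forallP/forallP => h x; apply/forallP => y.
    have /forallP/(_ (g y)) := h (g x).
    by rewrite !inE !gK -f1 !gK.
  by have /forallP/(_ (f y)) := h (f x); rewrite !inE f1.
congr << (_, _) >>; apply/clsP => //.
by rewrite -preimsetC; apply: sub.
Qed.

Lemma coprodU (K : fieldType) (T : finType) (P : dposet T) :
  coprod << cls P >> = dpcoprod K P.
Proof.
rewrite /coprod msuppU oner_eq0 big_seq_fset1 mcoeffUU scale1r.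
exact/dpcoprod_diso/diso_rep.
Qed.
(** * Hopf subalgebras spanned by families of double posets *)

Record family := Family {
  fam :> pred isoclass;
  fam1 : fam cone;
  famM : forall x y, fam x -> fam y -> fam (cmul x y);
  famS : forall x (I : {set 'I_(crd x)}), fam x -> fam (cls (dpsub (rep x) I))
}.

Section Span.
Variables (K : fieldType) (C : family).

(** The span of the isoclasses in [C]. *)
Definition hspan : {pred HDP K} := fun a => all C (msupp a).

Lemma hspanP a : reflect (forall p, a@_p != 0 -> C p) (a \in hspan).
Proof.
by apply: (iffP allP) => h p; [rewrite mcoeff_neq0 | rewrite -mcoeff_neq0]; apply: h.
Qed.

Lemma hspan_subalg : subalg_closed hspan.
Proof.
split=> [|c a b /hspanP ha /hspanP hb|a b /hspanP ha /hspanP hb].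
- apply/hspanP=> p; rewrite mcoeff1; case: (p =P cone) => [->|_]; rewrite ?eqxx //.
  by move=> _; apply: fam1.
- apply/hspanP=> p; rewrite mcoeffD mcoeffZ => nz.
  have [a0|] := eqVneq (a@_p) 0; last exact: ha.
  by apply: hb; apply: contraNneq nz => ->; rewrite a0 mulr0 addr0.
- apply/allP=> p /msuppM_le[k1 [k2 [k1a k2b ->]]].
  by apply: famM; [apply: ha | apply: hb]; rewrite mcoeff_neq0.
Qed.

HB.instance Definition _ := GRing.isSubalgClosed.Build K (HDP K) hspan hspan_subalg.

Record hsub := HSub { hval : HDP K; _ : hval \in hspan }.

HB.instance Definition _ := [isSub for hval].
HB.instance Definition _ := [Choice of hsub by <:].
HB.instance Definition _ := [SubChoice_isSubLalgebra of hsub by <:].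

Definition hbase (p : isoclass) : hsub := insubd 0 << p >>.

Lemma hbaseE p : C p -> hval (hbase p) = << p >>.
Proof.
move=> Cp; rewrite [LHS]val_insubd; case: ifP => // /negP[]; apply/hspanP=> q.
by rewrite mcoeffU; case: (p =P q) => [<-|]; rewrite ?eqxx.
Qed.

Lemma coprod_span (a : HDP K) : a \in hspan ->
  all (fun k => C k.1 && C k.2) (msupp (coprod a)).
Proof.
move=> /allP ha; apply/allP=> k; rewrite -mcoeff_neq0; apply: contraNT => nC.
rewrite raddf_sum /= big_seq big1 // => p /ha Cp.
rewrite mcoeffZ raddf_sum /= big1 ?mulr0 // => I _; rewrite mcoeffU.
by case: eqP => // ek; rewrite -ek /= !famS in nC.
Qed.

End Span.

(** [φ ⊗ φ], computed on the basis [p ⊗ q] of [hsub K C ⊗ hsub K C].  It is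
    only applied to tensors supported on pairs of classes in [C], see
    [coprod_span]. *)
Definition tensmap (K : fieldType) (C D : family) (phi : hsub K C -> hsub K D)
    (t : HDP2 K) : HDP2 K :=
  \sum_(k <- msupp t)
     t@_k *: tens (hval (phi (hbase K C k.1))) (hval (phi (hbase K C k.2))).

(** Compatibility with antipodes is automatic for a bialgebra morphism. *)
Definition coalg_morph (K : fieldType) (C D : family)
    (phi : hsub K C -> hsub K D) : Prop :=
  forall a, coprod (hval (phi a)) = tensmap phi (coprod (hval a)) /\
            counit (hval (phi a)) = counit (hval a).

Definition homogeneous (K : fieldType) (C D : family)
    (phi : hsub K C -> hsub K D) : Prop :=
  forall n a, homog n (hval a) -> homog n (hval (phi a)).

Definition isometric (K : fieldType) (C D : family)
    (phi : hsub K C -> hsub K D) : Prop :=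
  forall a b, pairing (hval (phi a)) (hval (phi b)) = pairing (hval a) (hval b).

(** * Plane and special plane posets *)

Definition plane (T : finType) (P : dposet T) : bool :=
  [forall x, forall y, (x != y) ==>
     ((le1 P x y || le1 P y x) == ~~ (le2 P x y || le2 P y x))].

(** [(T, <=_h, <=)] for the plane poset [Q = (T, <=_h, <=_r)]. *)
Definition special_plane (T : finType) (P : dposet T) : bool :=
  [exists Q : dposet T, plane Q &&
     [forall x, forall y, (le1 P x y == le1 Q x y) &&
                          (le2 P x y == le1 Q x y || le2 Q x y)]].

Lemma planeP (T : finType) (P : dposet T) :
  reflect (forall x y, x != y ->
     (le1 P x y || le1 P y x) = ~~ (le2 P x y || le2 P y x)) (plane P).
Proof.
apply: (iffP forallP) => [h x y nxy|h x].
  by have /forallP/(_ y)/implyP/(_ nxy)/eqP := h x.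
by apply/forallP=> y; apply/implyP=> nxy; apply/eqP/h.
Qed.

Lemma special_planeP (T : finType) (P : dposet T) :
  reflect (exists Q : dposet T, [/\ plane Q, forall x y, le1 P x y = le1 Q x y &
              forall x y, le2 P x y = le1 Q x y || le2 Q x y]) (special_plane P).
Proof.
apply: (iffP existsP) => -[Q]; last first.
  move=> [pQ h1 h2]; exists Q; rewrite pQ; apply/forallP=> x; apply/forallP=> y.
  by rewrite h1 h2 !eqxx.
move=> /andP[pQ /forallP h]; exists Q.
by split=> // x y; have /forallP/(_ y)/andP[/eqP ? /eqP ?] := h x.
Qed.

Lemma plane_pull (T U : finType) (f : U -> T) (fI : injective f) (P : dposet T) :
  plane P -> plane (dppull fI P).
Proof.
move=> /planeP h; apply/planeP=> x y nxy; rewrite !le1_pull !le2_pull.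
by apply: h; rewrite inj_eq.
Qed.

Lemma special_pull (T U : finType) (f : U -> T) (fI : injective f) (P : dposet T) :
  special_plane P -> special_plane (dppull fI P).
Proof.
move=> /special_planeP[Q [pQ h1 h2]]; apply/special_planeP.
exists (dppull fI Q); split; first exact: plane_pull.
  by move=> x y; rewrite !le1_pull.
by move=> x y; rewrite le1_pull !le2_pull.
Qed.

Lemma diso_pullE (T U : finType) (P : dposet T) (Q : dposet U) :
  diso P Q -> exists f : T -> U, exists fI : injective f, P = dppull fI Q.
Proof.
move=> /disoP[f [fb f1 f2]]; exists f; exists (bij_inj fb).
apply: val_inj; rewrite /= [LHS]surjective_pairing; congr pair; apply/setP.
  by move=> [x y]; rewrite inE f1.
by move=> [x y]; rewrite inE f2.
Qed.

Lemma plane_diso (T U : finType) (P : dposet T) (Q : dposet U) :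
  diso P Q -> plane Q -> plane P.
Proof. by move=> /diso_pullE[f [fI ->]]; apply: plane_pull. Qed.

Lemma special_diso (T U : finType) (P : dposet T) (Q : dposet U) :
  diso P Q -> special_plane Q -> special_plane P.
Proof. by move=> /diso_pullE[f [fI ->]]; apply: special_pull. Qed.

Lemma plane_mul (T U : finType) (P : dposet T) (Q : dposet U) :
  plane P -> plane Q -> plane (dpmul P Q).
Proof.
move=> /planeP hP /planeP hQ; apply/planeP=> -[x|x] [y|y] nxy.
all: rewrite !le1_mul !le2_mul //=.
  by apply: hP; apply: contraNneq nxy => ->.
by apply: hQ; apply: contraNneq nxy => ->.
Qed.

Lemma special_mul (T U : finType) (P : dposet T) (Q : dposet U) :
  special_plane P -> special_plane Q -> special_plane (dpmul P Q).
Proof.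
move=> /special_planeP[P' [pP hP1 hP2]] /special_planeP[Q' [pQ hQ1 hQ2]].
apply/special_planeP; exists (dpmul P' Q'); split; first exact: plane_mul.
  by move=> [x|x] [y|y]; rewrite !le1_mul /= ?hP1 ?hQ1.
by move=> [x|x] [y|y]; rewrite !le2_mul !le1_mul /= ?hP2 ?hQ2.
Qed.

Lemma plane_empty : plane dpempty. Proof. by apply/planeP=> -[]. Qed.

Lemma special_empty : special_plane dpempty.
Proof.
apply/special_planeP; exists dpempty.
by split; [exact: plane_empty | case | case].
Qed.

Lemma plane_rep1 : plane (rep cone).
Proof. exact: plane_diso (diso_rep _) plane_empty. Qed.

Lemma plane_repM x y : plane (rep x) -> plane (rep y) -> plane (rep (cmul x y)).
Proof. by move=> px py; apply: plane_diso (diso_rep _) (plane_mul px py). Qed.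

Lemma plane_repS x (I : {set 'I_(crd x)}) :
  plane (rep x) -> plane (rep (cls (dpsub (rep x) I))).
Proof. by move=> px; apply: plane_diso (diso_rep _) (plane_pull _ px). Qed.

Definition plane_family : family :=
  @Family (fun x => plane (rep x)) plane_rep1 plane_repM plane_repS.

Lemma special_rep1 : special_plane (rep cone).
Proof. exact: special_diso (diso_rep _) special_empty. Qed.

Lemma special_repM x y : special_plane (rep x) -> special_plane (rep y) -> special_plane (rep (cmul x y)).
Proof. by move=> px py; apply: special_diso (diso_rep _) (special_mul px py). Qed.

Lemma special_repS x (I : {set 'I_(crd x)}) :
  special_plane (rep x) -> special_plane (rep (cls (dpsub (rep x) I))).
Proof. by move=> px; apply: special_diso (diso_rep _) (special_pull _ px). Qed.

Definition special_plane_family : family :=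
  @Family (fun x => special_plane (rep x)) special_rep1 special_repM special_repS.

Notation HPP K := (hsub K plane_family).
Notation HSPP K := (hsub K special_plane_family).

(* Main.v *)
Require Import Defs.
From HB Require Import structures.
From mathcomp Require Import all_boot all_order all_algebra finmap.
From mathcomp.multinomials Require Import monalg.
From mathcomp Require Import all_fingroup.
From mathcomp Require Import zify ring.
From Stdlib Require Import ClassicalEpsilon.

(** Both Hopf algebras are graded, self-dual for their pairing, and monoid algebras
    of monoids in which factorizations refine each other (Levi's lemma, [cmul_levi]).
    An isometric isomorphism is therefore built degree by degree. Once it is known in
    degrees less than [N], its values on decomposable elements of degree [N] are
    forced; they are well defined by Levi's lemma, and these values are isometric
    because the pairing of two products is computed from coproducts in smaller
    degrees ([isometry_below_mul]). It remains to extend an isometry, defined on the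
    possibly degenerate subspace of decomposable elements, to the whole component of
    degree [N]. In characteristic different from 2, Witt's theorem ([witt_extension])
    does this as soon as the two components are isometric quadratic spaces.
    Compatibility with the coproduct is then automatic, by duality ([extendC]).

    The two quadratic spaces are compared through permutations, which parametrize
    plane posets ([plane_perm]). Pairing plane posets with their mirror images gives a
    unitriangular matrix, and mirror images have no fixed point in degree at least 2;
    so the form on plane posets is nondegenerate with a totally isotropic subspace of
    half the dimension, i.e. hyperbolic. Linear extensions identify the form on
    special plane posets, again by a unitriangular matrix, with the trace form of the
    group algebra of the symmetric group: an orthogonal sum of hyperbolic planes, one
    for each pair of distinct mutually inverse permutations, and of lines of norm 1,
    one for each involution or identity. The number of those lines is even in degree
    at least 2, and a square root of -1 turns the sum of two of them into a hyperbolic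
    plane ([inv_form_isotropic]). Both forms are then hyperbolic, hence isometric
    ([gram_congruent]).

    Conversely, degree 2 already yields a square root of -1 and excludes
    characteristic 2 ([isometry_necessary]). *)

Set Implicit Arguments.
Unset Strict Implicit.
Unset Printing Implicit Defensive.

Import GRing.Theory.
Local Open Scope nat_scope.

(** * Factorization of double posets *)

Definition dpemb (T U : finType) (P : dposet T) (Q : dposet U) (f : T -> U) : Prop :=
  [/\ injective f, forall x y, le1 Q (f x) (f y) = le1 P x y &
      forall x y, le2 Q (f x) (f y) = le2 P x y].

Definition csub (T : finType) (P : dposet T) (A : {set T}) : isoclass :=
  cls (dpsub P A).

Lemma le1_refl (T : finType) (P : dposet T) x : le1 P x x.
Proof. by have /porderbP[r _ _] := le1_porder P. Qed.
Lemma le2_refl (T : finType) (P : dposet T) x : le2 P x x.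
Proof. by have /porderbP[r _ _] := le2_porder P. Qed.
Lemma le1_anti (T : finType) (P : dposet T) x y : le1 P x y -> le1 P y x -> x = y.
Proof. by have /porderbP[_ a _] := le1_porder P => h h'; apply: a; rewrite h. Qed.
Lemma le2_anti (T : finType) (P : dposet T) x y : le2 P x y -> le2 P y x -> x = y.
Proof. by have /porderbP[_ a _] := le2_porder P => h h'; apply: a; rewrite h. Qed.

Lemma cls_emb (T U : finType) (P : dposet T) (Q : dposet U) (f : T -> U) :
  dpemb P Q f -> cls P = csub Q (f @: [set: T]).
Proof.
case=> fI f1 f2; apply/clsP/disoP.
have hf x : f x \in f @: [set: T] by apply: imset_f.
exists (fun x => Sub (f x) (hf x)); split.
- apply: inj_card_bij => [x y /(congr1 val) /= /fI //|].
  rewrite card_sig -[X in _ <= X]cardsT -(card_imset _ fI).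
  by apply/eq_leq/eq_card.
- by move=> x y; rewrite le1_pull /= f1.
- by move=> x y; rewrite le2_pull /= f2.
Qed.

Lemma csub_emb (T U : finType) (P : dposet T) (Q : dposet U) (f : T -> U) A :
  dpemb P Q f -> csub P A = csub Q (f @: A).
Proof.
case=> fI f1 f2; rewrite /csub (@cls_emb _ _ _ Q (f \o val)).
  congr csub; apply/setP=> y; apply/imsetP/imsetP => -[x hx ->].
    by exists (val x) => //; apply: (valP x).
  by exists (Sub x hx).
split=> [x y /fI/val_inj //|x y|x y] /=.
  by rewrite f1 le1_pull.
by rewrite f2 le2_pull.
Qed.

Lemma csubT (T : finType) (P : dposet T) : csub P [set: T] = cls P.
Proof.
rewrite (@cls_emb _ _ P P id); first by rewrite imset_id.
by split.
Qed.

Lemma crd_csub (T : finType) (P : dposet T) A : crd (csub P A) = #|A|.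
Proof. by rewrite crd_cls card_sig; apply: eq_card => x; rewrite inE. Qed.

Lemma crd_cone : crd cone = 0.
Proof. by rewrite crd_cls card_void. Qed.

Definition cut (T : finType) (P : dposet T) (A B : {set T}) : bool :=
  [forall a in A, forall b in B, [&& le2 P a b, ~~ le1 P a b & ~~ le1 P b a]].

Lemma cutP (T : finType) (P : dposet T) (A B : {set T}) :
  reflect (forall a b, a \in A -> b \in B ->
             [/\ le2 P a b, ~~ le1 P a b & ~~ le1 P b a]) (cut P A B).
Proof.
apply: (iffP forall_inP) => [h a b aA bB|h a aA].
  by have /forall_inP/(_ b bB)/and3P := h a aA.
by apply/forall_inP=> b bB; apply/and3P/h.
Qed.

(** Products are recognized inside a double poset by their left factor: a part that
    precedes the rest for the second order and is unrelated to it for the first. *)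
Lemma csub_cut (T : finType) (P : dposet T) (A B : {set T}) :
  cut P A B -> csub P (A :|: B) = cmul (csub P A) (csub P B).
Proof.
move/cutP=> h; rewrite cmul_cls.
pose f (x : {x | x \in A} + {x | x \in B}) := match x with inl a => val a | inr b => val b end.
rewrite (@cls_emb _ _ _ P f).
  congr csub; apply/setP=> x; rewrite inE; apply/orP/imsetP.
    by case=> hx; [exists (inl (Sub x hx)) | exists (inr (Sub x hx))].
  by case=> [[a|a]] _ -> /=; [left | right]; apply: (valP a).
split.
- move=> [a|a] [b|b] /=.
  + by move/val_inj->.
  + by move=> e; have [_] := h _ _ (valP a) (valP b); rewrite /= e le1_refl.
  + by move=> e; have [_] := h _ _ (valP b) (valP a); rewrite /= e le1_refl.
  + by move/val_inj->.
- move=> [a|a] [b|b]; rewrite le1_mul /= ?le1_pull //; apply/negbTE.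
    by have [] := h _ _ (valP a) (valP b).
  by have [] := h _ _ (valP b) (valP a).
- move=> [a|a] [b|b]; rewrite le2_mul /= ?le2_pull //.
    by have [] := h _ _ (valP a) (valP b).
  apply/negbTE/negP=> ab.
  have [ba + _] := h _ _ (valP b) (valP a).
  by rewrite /= (le2_anti ab ba) le1_refl.
Qed.

Lemma emb_inl (T U : finType) (P : dposet T) (Q : dposet U) :
  dpemb P (dpmul P Q) inl.
Proof. by split=> [x y []|x y|x y] //; rewrite ?le1_mul ?le2_mul. Qed.

Lemma emb_inr (T U : finType) (P : dposet T) (Q : dposet U) :
  dpemb Q (dpmul P Q) inr.
Proof. by split=> [x y []|x y|x y] //; rewrite ?le1_mul ?le2_mul. Qed.

Lemma csub_mul (T U : finType) (P : dposet T) (Q : dposet U) (A : {set T}) (B : {set U}) :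
  csub (dpmul P Q) (inl @: A :|: inr @: B) = cmul (csub P A) (csub Q B).
Proof.
rewrite csub_cut; first by rewrite -(csub_emb _ (emb_inl P Q)) -(csub_emb _ (emb_inr P Q)).
by apply/cutP=> _ _ /imsetP[x _ ->] /imsetP[y _ ->]; rewrite le2_mul !le1_mul.
Qed.

Lemma cut_of_mul x y z : x = cmul y z ->
  exists A, [/\ cut (rep x) A (~: A), y = csub (rep x) A & z = csub (rep x) (~: A)].
Proof.
move=> ->; have : diso (dpmul (rep y) (rep z)) (rep (cmul y z)) by rewrite diso_sym diso_rep.
case/disoP=> f [fb f1 f2].
have fe : dpemb (dpmul (rep y) (rep z)) (rep (cmul y z)) f by split=> //; apply: bij_inj.
pose A : {set 'I_(crd y) + 'I_(crd z)} := inl @: [set: 'I_(crd y)].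
have AC : ~: A = inr @: [set: 'I_(crd z)].
  apply/setP=> -[a|b]; rewrite !inE.
    by rewrite imset_f //; apply/esym/imsetP=> -[].
  by rewrite [RHS]imset_f //; apply/imsetP=> -[].
have fC : ~: (f @: A) = f @: (~: A).
  case: fb => g fK gK; apply/setP=> v; rewrite inE -(gK v).
  by rewrite !mem_imset ?inE //; apply: can_inj fK.
exists (f @: A); split.
- rewrite fC; apply/cutP=> _ _ /imsetP[a aA ->] /imsetP[b bA ->].
  move: aA bA; rewrite AC => /imsetP[a' _ ->] /imsetP[b' _ ->].
  by rewrite f2 !f1 le2_mul !le1_mul.
- by rewrite -(csub_emb _ fe) -(csub_emb _ (emb_inl _ _)) csubT repK.
- by rewrite fC AC -(csub_emb _ fe) -(csub_emb _ (emb_inr _ _)) csubT repK.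
Qed.

(** If neither of two left factors contained the other, an element of each would
    precede the other for the second order; so left factors form a chain. *)
Lemma cut_comparable (T : finType) (P : dposet T) (A A' : {set T}) :
  cut P A (~: A) -> cut P A' (~: A') -> #|A'| <= #|A| -> A' \subset A.
Proof.
move=> /cutP cA /cutP cA' le; have [//|/subsetPn[b bA' bA]] := boolP (A' \subset A).
suff AA' : A \subset A'.
  have /eqP e : A == A' by rewrite eqEcard AA'.
  by rewrite e bA' in bA.
apply/subsetP=> a aA; apply/negPn/negP=> aA'.
have [|h1 h _] := cA a b aA; first by rewrite inE.
have [|h2 _ _] := cA' b a bA'; first by rewrite inE.
by rewrite (le2_anti h1 h2) le1_refl in h.
Qed.

(** As left factors form a chain, two factorizations of a class have a common
    refinement (Levi's lemma). This is the form of unique factorization needed to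
    extend a multiplicative map, defined in small degrees, to products. *)
Lemma cmul_levi y z y' z' : cmul y z = cmul y' z' -> crd y' <= crd y ->
  exists t, y = cmul y' t /\ z' = cmul t z.
Proof.
move xE: (cmul y z) => x e; have [A [cA yA zA]] := cut_of_mul (esym xE).
have [A' [cA' yA' zA']] := cut_of_mul e; move: cA yA zA cA' yA' zA'.
set R := rep x => cA yA zA cA' yA' zA'.
rewrite yA yA' zA zA' !crd_csub => /(cut_comparable cA cA') sA.
exists (csub R (A :\: A')); split; rewrite -csub_cut.
- by rewrite setDE setUIr setUCr setIT (setUidPr sA).
- apply/cutP=> a b aA'; rewrite inE => /andP[bA' _].
  by move/cutP: cA'; apply; rewrite ?inE.
- congr csub; apply/setP=> u; rewrite !inE.
  by case: (boolP (u \in A)) => /=; rewrite ?andbT ?orbF // => /(contra (subsetP sA u)) ->.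
- apply/cutP=> a b; rewrite inE => /andP[_ aA] bA.
  by move/cutP: cA; apply.
Qed.

(** * Pictures *)

Lemma npictures_crd (T U : finType) (P : dposet T) (Q : dposet U) :
  npictures P Q != 0 -> #|T| = #|U|.
Proof.
rewrite -lt0n => /card_gt0P[f]; rewrite inE => /andP[/bijectivebP/bij_eq_card //].
Qed.

Lemma picturebP (T U : finType) (P : dposet T) (Q : dposet U) (f : T -> U) :
  reflect (forall i j, (le1 P i j -> le2 Q (f i) (f j)) /\
                       (le1 Q (f i) (f j) -> le2 P i j)) (pictureb P Q f).
Proof.
apply: (iffP forallP) => [h i j|h i].
  by have /forallP/(_ j)/andP[/implyP ? /implyP ?] := h i.
by apply/forallP=> j; have [h1 h2] := h i j; apply/andP; split; apply/implyP.
Qed.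

Lemma npictures_sym (T U : finType) (P : dposet T) (Q : dposet U) :
  npictures P Q = npictures Q P.
Proof.
wlog suff h : T U P Q / npictures P Q <= npictures Q P.
  by apply/eqP; rewrite eqn_leq !h.
have [->//|nz] := eqVneq (npictures P Q) 0.
have /card_gt0P[f0] : 0 < npictures P Q by rewrite lt0n.
rewrite inE => /andP[/bijectivebP[g0 fK0 gK0] _].
(* [F f] is the inverse of [f] when [f] is bijective *)
pose F (f : {ffun T -> U}) : {ffun U -> T} := [ffun u => odflt (g0 u) [pick t | f t == u]].
have FK (f : {ffun T -> U}) : bijective f -> cancel f (F f).
  move=> fb t; rewrite ffunE; case: pickP => [t' /eqP/(bij_inj fb) //|/(_ t)].
  by rewrite eqxx.
have KF (f : {ffun T -> U}) : bijective f -> cancel (F f) f.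
  by move=> fb; apply/(bij_can_sym fb)/FK.
have FI : {in [set f | bijectiveb f && pictureb P Q f] &, injective F}.
  move=> f f'; rewrite !inE => /andP[/bijectivebP fb _] /andP[/bijectivebP fb' _] e.
  by apply/ffunP=> t; apply: (can_inj (KF _ fb)); rewrite FK // e FK.
rewrite /npictures -(card_in_imset FI); apply/subset_leq_card/subsetP=> _ /imsetP[f + ->].
rewrite !inE => /andP[/bijectivebP fb /picturebP fp]; apply/andP; split.
  by apply/bijectivebP; exists f; [apply: KF | apply: FK].
apply/picturebP=> i j; have [h1 h2] := fp (F f i) (F f j).
by move: h1 h2; rewrite !KF.
Qed.

Section PictureMul.
Variables (T U V : finType) (P : dposet T) (Q : dposet U) (R : dposet V).

Definition glue (I : {set V})
    (fg : {ffun T -> {x | x \in ~: I}} * {ffun U -> {x | x \in I}}) : {ffun T + U -> V} :=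
  [ffun x => match x with inl t => val (fg.1 t) | inr u => val (fg.2 u) end].

Lemma glue_inj I : injective (@glue I).
Proof.
move=> [f g] [f' g'] /ffunP e; congr pair; apply/ffunP=> x; apply: val_inj.
  by have := e (inl x); rewrite !ffunE.
by have := e (inr x); rewrite !ffunE.
Qed.

Let pics := [set f : {ffun T + U -> V} | bijectiveb f && pictureb (dpmul P Q) R f].
Let im2 (f : {ffun T + U -> V}) : {set V} := [set f (inr u) | u : U].

(** The second factor follows the first one for [le2], so a picture cannot let
    [le1] go from the image of the second factor back to that of the first. *)
Lemma pics_upset f : f \in pics -> upset R (im2 f).
Proof.
rewrite inE => /andP[/bijectivebP[g fK gK] /picturebP fp].
apply/forallP=> v; apply/forallP=> w; apply/implyP=> /andP[/imsetP[u _ ->] uw].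
have := fp (inr u) (g w); rewrite gK => -[_ /(_ uw)]; rewrite le2_mul.
by case e: (g w) => [//|u'] _; apply/imsetP; exists u' => //; rewrite -e gK.
Qed.

Lemma pics_fibre I : upset R I ->
  [set f in pics | im2 f == I] =
  @glue I @: setX [set f | bijectiveb f && pictureb P (dpsub R (~: I)) f]
                  [set g | bijectiveb g && pictureb Q (dpsub R I) g].
Proof.
move=> /forallP uI; apply/setP=> f; rewrite inE; apply/andP/imsetP.
  move=> [fp /eqP fI]; move: (fp); rewrite inE => /andP[/bijectivebP fb /picturebP pf].
  have h2 u : f (inr u) \in I by rewrite -fI; apply: imset_f.
  have h1 t : f (inl t) \in ~: I.
    by rewrite inE -fI; apply/negP=> /imsetP[u _ /(bij_inj fb)].
  exists ([ffun t => Sub (f (inl t)) (h1 t)], [ffun u => Sub (f (inr u)) (h2 u)]); last first.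
    by apply/ffunP=> -[x|x]; rewrite !ffunE.
  case: fb => g fK gK.
  rewrite inE /= !inE; apply/andP; split; apply/andP; split.
  - apply/bijectivebP/inj_card_bij.
      by move=> x y; rewrite !ffunE => /(congr1 val)/= /(can_inj fK)[].
    rewrite card_sig -(card_codom (f := fun t => f (inl t))); last by move=> x y /(can_inj fK)[].
    apply/subset_leq_card/subsetP=> v; rewrite !inE -fI => nv.
    case e: (g v) => [t|u]; first by apply/codomP; exists t; rewrite -e gK.
    by case/imsetP: nv; exists u => //; rewrite -e gK.
  - apply/picturebP=> i j; rewrite !ffunE le2_pull le1_pull /=.
    by have := pf (inl i) (inl j); rewrite le1_mul le2_mul.
  - apply/bijectivebP/inj_card_bij.
      by move=> x y; rewrite !ffunE => /(congr1 val)/= /(can_inj fK)[].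
    rewrite card_sig -(card_codom (f := fun t => f (inr t))); last by move=> x y /(can_inj fK)[].
    apply/subset_leq_card/subsetP=> v; rewrite !inE -fI => /imsetP[u _ ->].
    by apply/codomP; exists u.
  - apply/picturebP=> i j; rewrite !ffunE le2_pull le1_pull /=.
    by have := pf (inr i) (inr j); rewrite le1_mul le2_mul.
move=> [[a b]]; rewrite inE /= !inE => /andP[/andP[/bijectivebP ab /picturebP ap]].
move=> /andP[/bijectivebP bb /picturebP bp] ->.
have nI (x : {x | x \in ~: I}) : (val x \in I) = false.
  by have : val x \in ~: I := valP x; rewrite inE => /negbTE.
have im : im2 (glue (a, b)) = I.
  apply/setP=> v; apply/imsetP/idP => [[u _ ->]|vI].
    by rewrite ffunE /= (valP (b u)).
  by case: bb => b' bK b'K; exists (b' (Sub v vI)); rewrite // ffunE /= b'K.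
rewrite im eqxx; split=> //; apply/andP; split.
  apply/bijectivebP/inj_card_bij; last first.
    rewrite card_sum (bij_eq_card ab) (bij_eq_card bb) !card_sig -(cardsC I) addnC.
    by apply/eq_leq; congr (_ + _); apply: eq_card => v; rewrite !inE.
  move=> [x|x] [y|y]; rewrite !ffunE /=.
  + by move/val_inj/(bij_inj ab)->.
  + by move=> e; have := nI (a x); rewrite /= e (valP (b y)).
  + by move=> e; have := nI (a y); rewrite /= -e (valP (b x)).
  + by move/val_inj/(bij_inj bb)->.
apply/picturebP=> -[i|i] [j|j]; rewrite !ffunE le1_mul le2_mul /=.
- by have := ap i j; rewrite le1_pull le2_pull.
- by split.
- split=> // h; have /forallP/(_ (val (a j)))/implyP := uI (val (b i)).
  by rewrite nI h (valP (b i)) => /(_ isT).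
- by have := bp i j; rewrite le1_pull le2_pull.
Qed.

(** The adjunction between product and coproduct, at the level of pictures: sort
    the pictures from a product by the upper set onto which they send the second
    factor. *)
Lemma npictures_mul : npictures (dpmul P Q) R =
  \sum_(I : {set V} | upset R I)
     npictures P (dpsub R (~: I)) * npictures Q (dpsub R I).
Proof.
rewrite /npictures -/pics -sum1_card (partition_big im2 (upset R)) => [|f]; last exact: pics_upset.
apply: eq_bigr => I uI; rewrite -cardsX -(card_imset _ (@glue_inj I)) -pics_fibre //.
by rewrite -sum1_card; apply: eq_bigl => f; rewrite inE.
Qed.

End PictureMul.

(** * Plane posets of permutations *)

Section PermPoset.
Variable n : nat.
Implicit Types r s t : 'S_n.

(** The points of the graph of [r], compared by south-west and by north-west
    dominance. These are the two orders of the plane poset attached to [r]. *)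
Definition le_sw r : rel 'I_n := fun i j => (i <= j) && (r i <= r j).
Definition le_nw r : rel 'I_n := fun i j => (i <= j) && (r j <= r i).
Definition le_tot : rel 'I_n := fun i j => i <= j.

Lemma ord_anti (i j : 'I_n) : i <= j -> j <= i -> i = j.
Proof. by move=> ij ji; apply/val_inj/anti_leq; rewrite ij. Qed.

Lemma le_sw_porder r : porderb (le_sw r).
Proof.
apply/porderbP; split=> [i|i j|j i k]; rewrite /le_sw ?leqnn //.
- by case/andP=> /andP[ij _] /andP[ji _]; apply: ord_anti.
- by move=> /andP[h1 h2] /andP[h3 h4]; rewrite (leq_trans h1 h3) (leq_trans h2 h4).
Qed.

Lemma le_nw_porder r : porderb (le_nw r).
Proof.
apply/porderbP; split=> [i|i j|j i k]; rewrite /le_nw ?leqnn //.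
- by case/andP=> /andP[ij _] /andP[ji _]; apply: ord_anti.
- by move=> /andP[h1 h2] /andP[h3 h4]; rewrite (leq_trans h1 h3) (leq_trans h4 h2).
Qed.

Lemma le_tot_porder : porderb le_tot.
Proof.
apply/porderbP; split=> [i|i j|j i k]; rewrite /le_tot //.
- by case/andP; apply: ord_anti.
- exact: leq_trans.
Qed.

Definition pposet r : dposet 'I_n := mkdposet (le_sw_porder r) (le_nw_porder r).
Definition sposet r : dposet 'I_n := mkdposet (le_sw_porder r) le_tot_porder.

Lemma le1_p r i j : le1 (pposet r) i j = (i <= j) && (r i <= r j).
Proof. exact: le1_mk. Qed.
Lemma le2_p r i j : le2 (pposet r) i j = (i <= j) && (r j <= r i).
Proof. exact: le2_mk. Qed.
Lemma le1_s r i j : le1 (sposet r) i j = (i <= j) && (r i <= r j).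
Proof. exact: le1_mk. Qed.
Lemma le2_s r i j : le2 (sposet r) i j = (i <= j).
Proof. exact: le2_mk. Qed.

Lemma le2_sp r i j : le2 (sposet r) i j = le1 (pposet r) i j || le2 (pposet r) i j.
Proof. by rewrite le2_s le1_p le2_p; lia. Qed.

Lemma perm_neq r (i j : 'I_n) : i != j -> (r i != r j :> nat).
Proof. by apply: contraNneq => /val_inj/perm_inj->. Qed.

Lemma plane_p r : plane (pposet r).
Proof.
apply/planeP=> i j ij; rewrite !le1_p !le2_p.
by have := perm_neq r ij; have : (i != j :> nat) by []; lia.
Qed.

Lemma special_s r : special_plane (sposet r).
Proof.
apply/special_planeP; exists (pposet r); split; first exact: plane_p.
  by move=> i j; rewrite le1_p le1_s.
exact: le2_sp.
Qed.

(** An increasing permutation preserves the number of smaller elements. *)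
Lemma perm_incr1 s : (forall i j : 'I_n, i <= j -> s i <= s j) -> s = 1%g.
Proof.
move=> h; have hs (i j : 'I_n) : i < j -> s i < s j.
  move=> ij; rewrite ltn_neqAle (h _ _ (ltnW ij)) andbT; apply: perm_neq.
  by apply/eqP=> e; rewrite e ltnn in ij.
have hr (i j : 'I_n) : (s j < s i) = (j < i).
  apply/idP/idP; last exact: hs.
  by apply: contraTT; rewrite -!leqNgt; apply: h.
apply/permP=> i; rewrite perm1; apply: val_inj => /=.
have cardlt (k : 'I_n) : #|[set j : 'I_n | j < k]| = k.
  rewrite cardsE -sum1_card big_mkcond /= -(big_mkord xpredT (fun j => if j < k then 1 else 0)).
  rewrite (big_cat_nat (n := k)) //=; last exact: ltnW.
  rewrite [X in X + _](eq_big_nat _ _ (F2 := fun=> 1)); last by move=> j /andP[_ ->].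
  rewrite [X in _ + X]big_nat_cond [X in _ + X]big1.
    by rewrite sum_nat_const_nat muln1 subn0 addn0.
  by move=> j /andP[/andP[kj _] _]; rewrite ltnNge kj.
rewrite -[LHS]cardlt -[RHS]cardlt -(card_preimset _ (@perm_inj _ s)).
by apply: eq_card => j; rewrite !inE hr.
Qed.

Lemma perm_same_order r s : (forall i j : 'I_n, r i <= r j -> s i <= s j) -> r = s.
Proof.
move=> h; suff e : (r^-1 * s)%g = 1%g by rewrite -[LHS]mulg1 -e mulKVg.
by apply: perm_incr1 => i j ij; rewrite !permM; apply: h; rewrite !permKV.
Qed.

(** The pairs that are not inversions, with the diagonal included. *)
Definition asc r : {set 'I_n * 'I_n} := [set p | le_sw r p.1 p.2].

Lemma asc_inj r s : asc r = asc s -> r = s.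
Proof.
move=> /setP e; apply: perm_same_order => i j rij.
have [ij|ji] := leqP i j.
  by have := e (i, j); rewrite !inE /= /le_sw ij rij.
have := e (j, i); rewrite !inE /= /le_sw (ltnW ji) /=.
rewrite leqNgt ltn_neqAle rij andbT perm_neq /=; last first.
  by rewrite eq_sym; apply: contraTneq ji => ->; rewrite ltnn.
by move/esym/negbT; lia.
Qed.

(** Reversing the values exchanges the two orders of [pposet r]. *)
Definition rev_perm r : 'S_n := (r * perm (@rev_ord_inj n))%g.

Lemma rev_permE r i : rev_perm r i = n - (r i).+1 :> nat.
Proof. by rewrite permM permE. Qed.

Lemma rev_permK : involutive rev_perm.
Proof. by move=> r; apply/permP=> i; rewrite !permM !permE rev_ordK. Qed.

Lemma rev_perm_le r i j : (rev_perm r i <= rev_perm r j) = (r j <= r i).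
Proof. by rewrite !rev_permE; have := ltn_ord (r i); have := ltn_ord (r j); lia. Qed.

(** Such a picture preserves the first order, hence sends the comparable pairs of
    [r] injectively to those of [s]. When their numbers agree it preserves and
    reflects both orders, and a plane poset has no automorphism but the identity. *)
Lemma picture_asc r s (f : {ffun 'I_n -> 'I_n}) :
  injective f -> pictureb (pposet r) (pposet (rev_perm s)) f ->
  #|asc r| <= #|asc s| /\ (#|asc r| = #|asc s| -> r = s /\ f = [ffun i => i]).
Proof.
move=> fI /picturebP fp.
pose F (p : 'I_n * 'I_n) := (f p.1, f p.2).
have FI : injective F by move=> [a b] [c d] [/fI-> /fI->].
have sub : F @: asc r \subset asc s.
  apply/subsetP=> _ /imsetP[[i j] + ->]; rewrite !inE /= /le_sw => ij.
  have [h _] := fp i j; move: h; rewrite le1_p le2_p rev_perm_le; exact.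
have le : #|asc r| <= #|asc s| by rewrite -(card_imset _ FI) subset_leq_card.
split=> // e.
have im : F @: asc r = asc s by apply/eqP; rewrite eqEcard sub (card_imset _ FI) e leqnn.
have fasc i j : le_sw s (f i) (f j) = le_sw r i j.
  by have := mem_imset (asc r) (i, j) FI; rewrite im !inE.
have finc (i j : 'I_n) : i <= j -> f i <= f j.
  move=> ij; have [->|nij] := eqVneq i j; first exact: leqnn.
  have [h1 _] := fp i j; have [_ h2] := fp j i; have := fasc j i; move: h1 h2.
  rewrite /le_sw !le1_p !le2_p !rev_perm_le ij /=.
  have ji : j <= i = false by apply/negbTE; rewrite -ltnNge ltn_neqAle ij andbT.
  rewrite ji /=; case: (leqP (r i) (r j)) => [_ /(_ isT)/andP[] //|rji _].
  case: (leqP (f j) (f i)) => [fji|/ltnW //] /=.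
  case: (leqP (s (f i)) (s (f j))) => [_ /(_ isT) //|sji _].
  by rewrite (ltnW sji).
have e1 : perm fI = 1%g by apply: perm_incr1 => i j ij; rewrite !permE; apply: finc.
have fid i : f i = i by have := congr1 (fun p : 'S_n => p i) e1; rewrite permE perm1.
split; last by apply/ffunP=> i; rewrite ffunE fid.
apply: asc_inj; apply/setP=> -[i j]; rewrite !inE /=.
by rewrite -fasc !fid.
Qed.

(** Pairing each plane poset with the mirror images of the others thus gives a
    triangular matrix, for the number of pairs comparable for the first order. *)
Lemma npictures_rev_neq0 r s : npictures (pposet r) (pposet (rev_perm s)) != 0 ->
  r = s \/ #|asc r| < #|asc s|.
Proof.
rewrite -lt0n => /card_gt0P[f]; rewrite inE => /andP[/bijectivebP/bij_inj fI].
case/(picture_asc fI); rewrite leq_eqVlt => /orP[/eqP e /(_ e)[]|]; first by left.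
by right.
Qed.

Lemma npictures_rev r : npictures (pposet r) (pposet (rev_perm r)) = 1.
Proof.
rewrite -(cards1 [ffun i : 'I_n => i]); apply: eq_card => f; rewrite !inE.
apply/andP/eqP => [[/bijectivebP/bij_inj fI]|->].
  by case/(picture_asc fI) => _ /(_ erefl)[].
split; first by apply/bijectivebP; exists id => i; rewrite ffunE.
apply/picturebP=> i j; rewrite !ffunE !le1_p !le2_p !rev_perm_le.
by split.
Qed.

(** The total order given by [t] extends the first order of [sposet r]. *)
Definition linext r t : bool := [forall i, forall j, le_sw r i j ==> (t i <= t j)].

Lemma linextP r t : reflect (forall i j : 'I_n, i <= j -> r i <= r j -> t i <= t j) (linext r t).
Proof.
apply: (iffP forallP) => [h i j ij rij|h i].
  by have /forallP/(_ j)/implyP := h i; apply; rewrite /le_sw ij rij.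
by apply/forallP=> j; apply/implyP=> /andP[]; apply: h.
Qed.

Lemma linext_refl r : linext r r. Proof. exact/linextP. Qed.

Lemma linext_asc r t : linext r t -> r = t \/ #|asc r| < #|asc t|.
Proof.
move=> /linextP h.
have sub : asc r \subset asc t.
  by apply/subsetP=> -[i j]; rewrite !inE /le_sw /= => /andP[ij rij]; rewrite ij h.
have := subset_leq_card sub; rewrite leq_eqVlt => /orP[/eqP e|]; last by right.
by left; apply: asc_inj; apply/eqP; rewrite eqEcard sub e leqnn.
Qed.

(** The second orders being total, a picture is a permutation that is a linear
    extension on one side and whose inverse is one on the other side. *)
Lemma npictures_special r s :
  npictures (sposet r) (sposet s) = \sum_(t : 'S_n) linext r t * linext s t^-1%g.
Proof.
rewrite (eq_bigr (fun t => nat_of_bool (linext r t && linext s t^-1%g))); last by move=> t _; rewrite mulnb.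
rewrite -big_mkcond /= sum1_card.
have FI : injective (fun t : 'S_n => [ffun i => t i]).
  by move=> t t' /ffunP e; apply/permP=> i; have := e i; rewrite !ffunE.
rewrite /npictures -(card_imset _ FI); apply: eq_card => f; rewrite !inE.
have pE (t : 'S_n) : pictureb (sposet r) (sposet s) [ffun i => t i] = linext r t && linext s t^-1%g.
  apply/picturebP/andP => [h|[/linextP h1 /linextP h2] i j].
    split; apply/linextP=> i j ij rij.
      by have [+ _] := h i j; rewrite le1_s le2_s !ffunE ij rij; apply.
    by have [_] := h (t^-1 i)%g (t^-1 j)%g; rewrite le1_s le2_s !ffunE !permKV ij rij; apply.
  rewrite !ffunE !le1_s !le2_s; split=> /andP[ij rij]; first exact: h1.
  by have := h2 _ _ ij rij; rewrite !permK.
apply/andP/imsetP=> [[/bijectivebP/bij_inj fI pf]|[t + ->]].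
  have fE : f = [ffun i => perm fI i] by apply/ffunP=> i; rewrite ffunE permE.
  by exists (perm fI) => //; rewrite unfold_in -pE -fE.
rewrite unfold_in -pE => ->; split=> //; apply/bijectivebP; exists (t^-1)%g => i.
  by rewrite ffunE permK.
by rewrite ffunE permKV.
Qed.

(** When [1 < n], a choice of one element in each pair [{r, rev_perm r}]: the one with
    more ascending pairs, ties being broken by an arbitrary enumeration. *)
Definition upper r : bool :=
  (#|asc (rev_perm r)| < #|asc r|) ||
  (#|asc (rev_perm r)| == #|asc r|) && (enum_rank r < enum_rank (rev_perm r)).

(** A picture would give [#|asc r| <= #|asc (rev_perm s)|] and
    [#|asc s| <= #|asc (rev_perm r)|]. For upper permutations all four numbers are
    then equal, so that [r] is [rev_perm s], which is not upper. *)
Lemma npictures_upper r s : upper r -> upper s -> npictures (pposet r) (pposet s) = 0.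
Proof.
move=> ur us; apply/eqP/negPn/negP=> nz.
have le_up u : upper u -> #|asc (rev_perm u)| <= #|asc u|.
  by rewrite /upper => /orP[/ltnW //|/andP[/eqP->]].
have /npictures_rev_neq0 h1 : npictures (pposet r) (pposet (rev_perm (rev_perm s))) != 0 by rewrite rev_permK.
have /npictures_rev_neq0 h2 : npictures (pposet s) (pposet (rev_perm (rev_perm r))) != 0.
  by rewrite rev_permK npictures_sym.
have le1 : #|asc r| <= #|asc (rev_perm s)| by case: h1 => [->|/ltnW].
have le2 : #|asc s| <= #|asc (rev_perm r)| by case: h2 => [->|/ltnW].
have l1 := le_up _ ur; have l2 := le_up _ us.
have e : r = rev_perm s by case: h1 => //; lia.
by move: ur us; rewrite /upper e rev_permK; lia.
Qed.

Lemma upper_rev r : 1 < n -> upper (rev_perm r) = ~~ upper r.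
Proof.
move=> n1; have ne : enum_rank r != enum_rank (rev_perm r) :> nat.
  apply/eqP=> /val_inj/enum_rank_inj/permP/(_ (r^-1 (Ordinal (ltnW n1)))%g)/(congr1 val).
  by rewrite /= rev_permE permKV /=; lia.
rewrite /upper rev_permK; lia.
Qed.

Lemma sposet_inj r s : diso (sposet r) (sposet s) -> r = s.
Proof.
case/disoP=> f [/bij_inj fI f1 f2].
have e1 : perm fI = 1%g by apply: perm_incr1 => i j; rewrite !permE; have := f2 i j; rewrite !le2_s => ->.
have fid i : f i = i by have := congr1 (fun p : 'S_n => p i) e1; rewrite permE perm1.
apply: asc_inj; apply/setP=> -[i j]; rewrite !inE /=.
by have := f1 i j; rewrite !fid !le1_s.
Qed.

End PermPoset.

(** * The permutation of a plane poset *)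

Section Rank.
Variables (T : finType) (R : rel T).
Hypotheses (Rr : reflexive R) (Ra : antisymmetric R) (Rt : transitive R) (Rl : total R).

Lemma rank_subproof x : #|[set y | R y x && (y != x)]| < #|T|.
Proof.
rewrite -cardsT; apply: proper_card; apply/properP; split; first exact: subsetT.
by exists x; rewrite ?inE ?eqxx ?andbF.
Qed.

Definition rank x : 'I_#|T| := Ordinal (rank_subproof x).

Lemma rank_le x y : (rank x <= rank y) = R x y.
Proof.
apply/idP/idP => /= [|xy]; last first.
  apply/subset_leq_card/subsetP=> z; rewrite !inE => /andP[zx nzx].
  rewrite (Rt zx xy); apply: contraNneq nzx => zy.
  by apply/eqP/Ra; rewrite zx zy xy.
apply: contraTT => nxy; rewrite -ltnNge; apply: proper_card.
have yx : R y x by have := Rl x y; rewrite (negPf nxy).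
apply/properP; split.
  apply/subsetP=> z; rewrite !inE => /andP[zy nzy].
  rewrite (Rt zy yx); apply: contraNneq nxy => zx; rewrite -zx //.
exists y; rewrite !inE ?eqxx ?andbF // yx.
by apply: contraNneq nxy => ->.
Qed.

Lemma rank_bij : bijective rank.
Proof.
apply: inj_card_bij; last by rewrite card_ord.
by move=> x y e; apply: Ra; rewrite -!rank_le e leqnn.
Qed.

End Rank.

(** The delicate point is transitivity in the mixed cases: if [h x y] and [r y z],
    then comparing [z] to [x] the other way round would make two of the points
    comparable for both relations. *)
Lemma plane_union (T : finType) (h r : rel T) : porderb h -> porderb r ->
  (forall x y, x != y -> (h x y || h y x) = ~~ (r x y || r y x)) ->
  let R := fun x y => h x y || r x y in
  [/\ reflexive R, antisymmetric R, transitive R & total R].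
Proof.
move=> /porderbP[hr ha ht] /porderbP[rr ra rt] hp R.
have excl x y : h x y -> r x y || r y x -> x = y.
  move=> hxy rxy; apply/eqP/negPn/negP=> nxy.
  by have := hp x y nxy; rewrite rxy hxy.
split.
- by move=> x; rewrite /R hr.
- move=> x y /andP[/orP[xy|xy] /orP[yx|yx]].
  + by apply: ha; rewrite xy.
  + by apply: excl => //; rewrite yx orbT.
  + by apply/esym/excl => //; rewrite xy orbT.
  + by apply: ra; rewrite xy.
- have tot x y : x != y -> [|| h x y, h y x, r x y | r y x].
    by move=> /hp; case: (h x y); case: (h y x); case: (r x y); case: (r y x).
  move=> y x z /orP[xy|xy] /orP[yz|yz]; rewrite /R.
  + by rewrite (ht _ _ _ xy yz).
  + have [<-|nxz] := eqVneq x z; first by rewrite hr.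
    case/or4P: (tot _ _ nxz) => [->//|zx|->|zx]; rewrite ?orbT //.
      have zy := ht _ _ _ zx xy.
      have e : z = y by apply: excl => //; rewrite yz orbT.
      by rewrite e xy.
    have yx := rt _ _ _ yz zx.
    have e : x = y by apply: excl => //; rewrite yx orbT.
    by rewrite e yz orbT.
  + have [<-|nxz] := eqVneq x z; first by rewrite hr.
    case/or4P: (tot _ _ nxz) => [->//|zx|->|zx]; rewrite ?orbT //.
      have yx := ht _ _ _ yz zx.
      have e : y = x by apply: excl => //; rewrite xy orbT.
      by rewrite -e yz.
    have zy := rt _ _ _ zx xy.
    have e : y = z by apply: excl => //; rewrite zy orbT.
    by rewrite -e xy orbT.
  + by rewrite (rt _ _ _ xy yz) orbT.
- move=> x y; rewrite /R; have [->|/hp] := eqVneq x y; first by rewrite hr.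
  by case: (h x y); case: (h y x); case: (r x y); case: (r y x).
Qed.

(** The union of the first order with the second one, and its union with the
    opposite of the second one, are total orders: number the elements by both. *)
Lemma plane_perm (T : finType) (P : dposet T) : plane P ->
  exists r : 'S_#|T|, diso (pposet r) P.
Proof.
move=> /planeP hp.
have [r1 a1 t1 l1] := plane_union (le1_porder P) (le2_porder P) hp.
pose r' := fun x y => le2 P y x.
have r'P : porderb r'.
  have /porderbP[rr ra rt] := le2_porder P; apply/porderbP; split=> [//|x y|y x z xy yz].
    by rewrite andbC; apply: ra.
  exact: rt yz xy.
have hp' x y : x != y -> (le1 P x y || le1 P y x) = ~~ (r' x y || r' y x).
  by move=> /hp->; rewrite orbC.
have [r2 a2 t2 l2] := plane_union (le1_porder P) r'P hp'.
set R1 := fun x y => _ in r1 a1 t1 l1; set R2 := fun x y => _ in r2 a2 t2 l2.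
have e1 := rank_le r1 a1 t1 l1; have e2 := rank_le r2 a2 t2 l2.
have [a' aK a'K] := rank_bij r1 a1 t1 l1; have [b' bK b'K] := rank_bij r2 a2 t2 l2.
have pI : injective (fun i => rank R2 (a' i)) by apply: inj_comp; [apply: can_inj bK | apply: can_inj a'K].
exists (perm pI); apply/disoP; exists a'; split; first by exists (rank R1).
  move=> i j; rewrite le1_p !permE e2 -[i <= j](_ : R1 (a' i) (a' j) = _); last by rewrite -e1 !a'K.
  rewrite /R1 /R2 /r'; have [->|nij] := eqVneq (a' i) (a' j); first by rewrite le1_refl.
  have: ~~ (le2 P (a' i) (a' j) && le2 P (a' j) (a' i)).
    by apply: contra nij => /andP[ij ji]; rewrite (le2_anti ij ji).
  by case: (le1 P _ _); case: (le2 P _ _); case: (le2 P _ _).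
move=> i j; rewrite le2_p !permE e2 -[i <= j](_ : R1 (a' i) (a' j) = _); last by rewrite -e1 !a'K.
rewrite /R1 /R2 /r'; have [->|nij] := eqVneq (a' i) (a' j); first by rewrite le1_refl le2_refl.
have: ~~ (le1 P (a' i) (a' j) && le1 P (a' j) (a' i)).
  by apply: contra nij => /andP[ij ji]; rewrite (le1_anti ij ji).
by case: (le1 P _ _); case: (le1 P _ _); case: (le2 P _ _).
Qed.

Lemma diso_special (T U : finType) (P Q : dposet T) (P' Q' : dposet U) :
  (forall x y, le1 P' x y = le1 Q' x y) ->
  (forall x y, le2 P' x y = le1 Q' x y || le2 Q' x y) ->
  (forall x y, le1 P x y = le1 Q x y) ->
  (forall x y, le2 P x y = le1 Q x y || le2 Q x y) -> diso Q Q' -> diso P P'.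
Proof.
move=> h1' h2' h1 h2 /disoP[f [fb f1 f2]]; apply/disoP; exists f; split=> // x y.
  by rewrite h1' f1 h1.
by rewrite h2' f1 f2 h2.
Qed.

Lemma special_perm (T : finType) (P : dposet T) : special_plane P ->
  exists r : 'S_#|T|, diso (sposet r) P.
Proof.
case/special_planeP=> Q [/plane_perm[r qr] h1 h2]; exists r.
apply: diso_special h1 h2 _ _ qr => x y; last exact: le2_sp.
by rewrite le1_s le1_p.
Qed.

(** The special plane poset is built from the plane poset pointwise, by replacing
    the second order with the union, and this commutes with products. *)
Lemma sposet_cmul n k l (r : 'S_n) (r1 : 'S_k) (r2 : 'S_l) :
  cls (pposet r) = cmul (cls (pposet r1)) (cls (pposet r2)) ->
  cls (sposet r) = cmul (cls (sposet r1)) (cls (sposet r2)).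
Proof.
rewrite !cmul_cls => /clsP h; apply/clsP; apply: diso_special h.
- by move=> [x|x] [y|y]; rewrite !le1_mul //= le1_s le1_p.
- by move=> [x|x] [y|y]; rewrite !le2_mul !le1_mul //= le2_sp.
- by move=> x y; rewrite le1_s le1_p.
- exact: le2_sp.
Qed.

Lemma pposet_inj n (r s : 'S_n) : diso (pposet r) (pposet s) -> r = s.
Proof.
move=> h; apply: sposet_inj.
by apply: (diso_special _ _ _ _ h) => i j; rewrite ?le2_sp ?le1_s ?le1_p.
Qed.

Local Open Scope ring_scope.

(** * Witt's extension theorem *)

Definition bform (K : fieldType) (m : nat) (B : 'M[K]_m) (x y : 'rV[K]_m) : K :=
  (x *m B *m y^T) 0 0.

Section Bform.
Variables (K : fieldType) (m : nat) (B : 'M[K]_m).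
Local Notation b := (bform B).

Lemma bformDl x y z : b (x + y) z = b x z + b y z.
Proof. by rewrite /bform !mulmxDl mxE. Qed.

Lemma bformDr x y z : b x (y + z) = b x y + b x z.
Proof. by rewrite /bform linearD mulmxDr mxE. Qed.

Lemma bformZl a x y : b (a *: x) y = a * b x y.
Proof. by rewrite /bform -!scalemxAl mxE. Qed.

Lemma bformZr a x y : b x (a *: y) = a * b x y.
Proof. by rewrite /bform linearZ /= -scalemxAr mxE. Qed.

Lemma bformNl x y : b (- x) y = - b x y.
Proof. by rewrite -scaleN1r bformZl mulN1r. Qed.

Lemma bformNr x y : b x (- y) = - b x y.
Proof. by rewrite -scaleN1r bformZr mulN1r. Qed.

Definition bformE := (bformDl, bformDr, bformNl, bformNr, bformZl, bformZr).

Lemma bform_mx (x y : 'rV_m) : x *m B *m y^T = (b x y)%:M.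
Proof. by rewrite [LHS]mx11_scalar. Qed.

Lemma bform_scale (x y z : 'rV_m) : x *m (B *m y^T *m z) = b x y *: z.
Proof. by rewrite !mulmxA bform_mx mul_scalar_mx. Qed.

Lemma bform_sym x y : B^T = B -> b x y = b y x.
Proof.
by move=> Bs; rewrite /bform -[in LHS](trmxK (x *m B *m y^T)) mxE !trmx_mul trmxK Bs mulmxA.
Qed.

Lemma isometry_mx (H : 'M_m) :
  (forall x y, b (x *m H) (y *m H) = b x y) -> H *m B *m H^T = B.
Proof.
move=> h; apply/matrixP=> i j.
have e (A : 'M[K]_m) : A i j = bform A (delta_mx 0 i) (delta_mx 0 j).
  by rewrite /bform trmx_delta -colE -rowE !mxE.
by rewrite [LHS]e [RHS]e -[RHS](h _ _) /bform trmx_mul !mulmxA.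
Qed.

End Bform.

Section Witt.
Variables (K : fieldType) (m : nat) (B : 'M[K]_m).
Hypotheses (K2 : (2 : K) != 0) (Bs : B^T = B) (Bu : B \in unitmx).
Local Notation b := (bform B).

(** A linear form separating [u] from the rows of [C] is represented by a vector,
    as the form is nondegenerate. *)
Lemma bform_dual k (C : 'M[K]_(k, m)) (u : 'rV_m) :
  ~~ (u <= C)%MS -> exists z : 'rV_m, b u z = 1 /\ C *m B *m z^T = 0.
Proof.
move=> nuC.
have /matrix0Pn[i [j nz]] : u *m cokermx C != 0 by rewrite -submxE.
pose y := (cokermx C *m delta_mx j (0 : 'I_1)).
have uy : u *m y = ((u *m cokermx C) 0 j)%:M.
  by rewrite mulmxA -colE [LHS]mx11_scalar mxE.
have Cy : C *m y = 0 by rewrite mulmxA mulmx_coker mul0mx.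
rewrite (ord1 i) in nz.
exists ((((u *m cokermx C) 0 j)^-1 *: (invmx B *m y))^T).
rewrite /bform trmxK -!scalemxAr -!mulmxA !(mulKVmx Bu) uy Cy scaler0; split=> //.
by rewrite mxE [X in _ * X]mxE eqxx mulr1n mulVf.
Qed.

(** Move [u] to [v] by the reflection along [u - v]. When this vector is isotropic,
    use instead an Eichler transvection, or a hyperbolic scaling if [u] lies in the
    span of [u - v] and [C]. *)
Lemma witt_step k (C : 'M[K]_(k, m)) (u v : 'rV_m) :
  ~~ (u <= C)%MS -> ~~ (v <= C)%MS ->
  C *m B *m u^T = C *m B *m v^T -> b u u = b v v ->
  exists H, [/\ H *m B *m H^T = B, C *m H = C & u *m H = v].
Proof.
move=> nuC nvC Cuv buv; pose d := u - v.
have sym := bform_sym _ _ Bs.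
have Cd : C *m B *m d^T = 0 by rewrite linearB /= mulmxBr Cuv subrr.
have dd : b d d = 2 * b u d by rewrite !bformE -buv (sym v u); ring.
have uvd : v = u - d by rewrite opprB addrC subrK.
clearbody d.
have [d0|dn0] := eqVneq (b d d) 0; last first.
  (* the reflection along [d] *)
  exists (1%:M - (2 / b d d) *: (B *m d^T *m d)).
  have E x : x *m (1%:M - (2 / b d d) *: (B *m d^T *m d)) =
     x - (2 / b d d * b x d) *: d.
    by rewrite mulmxBr mulmx1 -scalemxAr bform_scale scalerA.
  split.
  - apply: isometry_mx => x y; rewrite !E !bformE (sym d y) .
    by field.
  - by rewrite mulmxBr mulmx1 -scalemxAr !mulmxA Cd mul0mx scaler0 subr0.
  - rewrite E uvd; congr (_ - _); rewrite -[RHS]scale1r; congr (_ *: _).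
    by rewrite mulrAC -dd divff.
have ud : b u d = 0.
  by apply/eqP; move/eqP: d0; rewrite dd mulf_eq0 (negPf K2).
have [|nudC] := boolP (u <= col_mx d C)%MS; last first.
  (* an Eichler transvection *)
  have [z [uz dCz]] := bform_dual nudC.
  have [dz Cz] : b d z = 0 /\ C *m B *m z^T = 0.
    move: dCz; rewrite !mul_col_mx -[0]vsubmxK => /eq_col_mx[h1 h2].
    by rewrite /bform h1 h2 !linear0 mxE.
  pose q := b z z / 2.
  exists (1%:M + B *m d^T *m z - B *m z^T *m d - q *: (B *m d^T *m d)).
  have E x : x *m (1%:M + B *m d^T *m z - B *m z^T *m d - q *: (B *m d^T *m d)) =
     x + b x d *: z - b x z *: d - (q * b x d) *: d.
    by rewrite !mulmxBr mulmxDr mulmx1 -scalemxAr !bform_scale scalerA.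
  split.
  - apply: isometry_mx => x y; rewrite !E !bformE d0 dz (sym z d) dz.
    rewrite (sym d y) (sym z y) /q; field.
    by [].
  - rewrite !mulmxBr mulmxDr mulmx1 -scalemxAr !mulmxA Cd Cz.
    by rewrite !mul0mx scaler0 !subr0 addr0.
  - by rewrite E uvd ud uz scale0r addr0 scale1r mulr0 scale0r subr0.
move=> /submxP[w]; rewrite -[w]hsubmxK; set w1 := lsubmx w; set w2 := rsubmx w.
rewrite mul_row_col [w1]mx11_scalar mul_scalar_mx; set c := w1 0 0 => ue.
have c0 : c != 0.
  by apply: contraNneq nuC => c0; rewrite ue c0 scale0r add0r submxMl.
have ve : v = (c - 1) *: d + w2 *m C.
  by rewrite uvd {1}ue scalerBl scale1r addrAC.
have c1 : c - 1 != 0.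
  by apply: contraNneq nvC => c1; rewrite ve c1 scale0r add0r submxMl.
have ndC : ~~ (d <= C)%MS.
  by apply: contra nuC => dC; rewrite ue addmx_sub ?submxMl // scalemx_sub.
have [e0 [de0 Ce0]] := bform_dual ndC.
pose e := e0 - (b e0 e0 / 2) *: d.
have de : b d e = 1 by rewrite !bformE de0 d0 mulr0 subr0.
have ee : b e e = 0.
  by rewrite !bformE de0 d0 (sym e0 d) de0; field.
have Ce : C *m B *m e^T = 0.
  by rewrite linearB linearZ /= mulmxBr -scalemxAr Ce0 Cd scaler0 subr0.
clearbody e.
(* [d] is multiplied by [l] and [e] divided by it, with [l] chosen so that [u],
   whose coordinate along [d] is [c], gets coordinate [c - 1] *)
pose l := (c - 1) / c.
exists (1%:M + (l - 1) *: (B *m e^T *m d) + (l^-1 - 1) *: (B *m d^T *m e)).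
have E x : x *m (1%:M + (l - 1) *: (B *m e^T *m d) + (l^-1 - 1) *: (B *m d^T *m e)) =
   x + ((l - 1) * b x e) *: d + ((l^-1 - 1) * b x d) *: e.
  by rewrite !mulmxDr mulmx1 -!scalemxAr !bform_scale !scalerA.
have CH : C *m (1%:M + (l - 1) *: (B *m e^T *m d) + (l^-1 - 1) *: (B *m d^T *m e)) = C.
  by rewrite !mulmxDr mulmx1 -!scalemxAr !mulmxA Cd Ce !mul0mx !scaler0 !addr0.
split=> //.
- apply: isometry_mx => x y; rewrite !E !bformE ee d0 de (sym e d) de.
  rewrite (sym d y) (sym e y) /l; field.
  by rewrite c0.
- rewrite ue mulmxDl -(mulmxA w2) CH -scalemxAl E de d0 mulr0 scale0r addr0 mulr1.
  rewrite ve; congr (_ + _); rewrite scalerDr scalerA -scalerDl.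
  by congr (_ *: _); rewrite /l; field.
Qed.

(** Witt's extension theorem: adjoin the rows one at a time, correcting the isometry
    by [witt_step]. The rows of [A1] may span a degenerate subspace. *)
Theorem witt_extension k (A1 A2 : 'M[K]_(k, m)) :
  row_free A1 -> row_free A2 -> A1 *m B *m A1^T = A2 *m B *m A2^T ->
  exists H, H *m B *m H^T = B /\ A1 *m H = A2.
Proof.
have split_free k' (a : 'rV[K]_m) (C : 'M[K]_(k', m)) :
    row_free (col_mx a C) -> row_free C /\ ~~ (a <= C)%MS.
  move=> fr; have: row_free C.
    apply/inj_row_free=> w wC.
    have /eqP: row_mx 0 w *m col_mx a C = 0 by rewrite mul_row_col mul0mx add0r.
    rewrite mulmx_free_eq0 // => /eqP/(congr1 rsubmx).
    by rewrite row_mxKr linear0.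
  move=> frC; split=> //; apply/negP=> /submxP[w aw].
  have /eqP: row_mx 1%:M (- w) *m col_mx a C = 0.
    by rewrite mul_row_col mul1mx mulNmx aw subrr.
  rewrite mulmx_free_eq0 // => /eqP/(congr1 lsubmx).
  by rewrite row_mxKl linear0 => /matrixP/(_ 0 0)/eqP; rewrite !mxE oner_eq0.
elim: k A1 A2 => [|k IH] A1 A2.
  by move=> _ _ _; exists 1%:M; rewrite mul1mx trmx1 mulmx1 !(flatmx0 A1) (flatmx0 A2) flatmx0.
rewrite -[A1](@vsubmxK _ 1 k) -[A2](@vsubmxK _ 1 k).
move: (@usubmx _ 1 k _ A1) (@dsubmx _ 1 k _ A1) => a1 C1.
move: (@usubmx _ 1 k _ A2) (@dsubmx _ 1 k _ A2) => a2 C2.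
have: row_free (col_mx a1 C1) -> row_free (col_mx a2 C2) ->
    col_mx a1 C1 *m B *m (col_mx a1 C1)^T = col_mx a2 C2 *m B *m (col_mx a2 C2)^T ->
    exists H, H *m B *m H^T = B /\ col_mx a1 C1 *m H = col_mx a2 C2; last exact.
move=> /split_free[f1 n1] /split_free[f2 n2].
rewrite !tr_col_mx !mul_col_mx !mul_mx_row => /eq_col_mx.
case=> /eq_row_mx[aa ac] /eq_row_mx[ca cc].
have [H0 [H0B CH0]] := IH _ _ f1 f2 cc.
have H0u : H0 \in unitmx.
  by have := Bu; rewrite -{1}H0B !unitmx_mul => /andP[/andP[]].
have n1' : ~~ (a1 *m H0 <= C2)%MS.
  rewrite -CH0; apply: contra n1 => /submxP[w ww].
  by apply/submxP; exists w; apply: (can_inj (mulmxK H0u)); rewrite ww mulmxA.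
have := witt_step n1' n2; case.
- by rewrite -ca -[in LHS]CH0 trmx_mul !mulmxA -(mulmxA C1 H0) -(mulmxA C1 (H0 *m B)) H0B.
- by rewrite /bform trmx_mul !mulmxA -(mulmxA a1 H0) -(mulmxA a1 (H0 *m B)) H0B aa.
move=> H1 [H1B CH1 aH1]; exists (H0 *m H1); split.
  by rewrite trmx_mul !mulmxA -(mulmxA H0 H1) -(mulmxA H0 (H1 *m B)) H1B.
by rewrite mul_col_mx !mulmxA CH0 CH1 aH1.
Qed.

(** Take vectors dual to the rows of [L], and make them isotropic by subtracting half
    of their Gram matrix along [L]: the form is hyperbolic. *)
Lemma hyperbolic_basis k (L : 'M[K]_(k, m)) :
  row_free L -> L *m B *m L^T = 0 ->
  exists S : 'M_(k + k, m), S *m B *m S^T = block_mx 0 1%:M 1%:M 0.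
Proof.
move=> Lf L0.
have /row_freeP[Z LZ] : row_free (L *m B) by rewrite /row_free mxrankMfree // row_free_unit.
pose M := Z^T; have LM : L *m B *m M^T = 1%:M by rewrite trmxK.
have ML : M *m B *m L^T = 1%:M.
  by apply: trmx_inj; rewrite !trmx_mul trmxK Bs mulmxA LM trmx1.
pose E := M *m B *m M^T.
have Es : E^T = E by rewrite /E !trmx_mul trmxK Bs mulmxA.
pose M' := M - 2^-1 *: (E *m L).
have LM' : L *m B *m M'^T = 1%:M.
  rewrite linearB linearZ /= mulmxBr trmx_mul -scalemxAr !mulmxA L0.
  by rewrite mul0mx scaler0 subr0 LM.
have ML' : M' *m B *m L^T = 1%:M.
  by apply: trmx_inj; rewrite !trmx_mul trmxK Bs mulmxA LM' trmx1.
have MM' : M' *m B *m M'^T = 0.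
  rewrite {1}/M' !mulmxBl -!scalemxAl -!(mulmxA E) LM' mulmx1.
  rewrite linearB linearZ /= mulmxBr trmx_mul -scalemxAr !mulmxA ML mul1mx Es.
  rewrite -/E -{1}[E]scale1r -!scalerBl.
  by rewrite (_ : _ - _ = 0) ?scale0r //; field.
exists (col_mx L M').
by rewrite tr_col_mx mul_col_mx mul_col_mx !mul_mx_row LM' ML' MM' L0 -block_mxEv.
Qed.

End Witt.

(** Both forms are congruent to the same hyperbolic form. *)
Lemma hyperbolic_congruent (K : fieldType) m k1 k2 (B1 B2 : 'M[K]_m)
    (L1 : 'M[K]_(k1, m)) (L2 : 'M[K]_(k2, m)) :
  (2 : K) != 0 -> B1^T = B1 -> B2^T = B2 -> B1 \in unitmx -> B2 \in unitmx ->
  m = (k1 + k1)%N -> m = (k2 + k2)%N -> row_free L1 -> row_free L2 ->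
  L1 *m B1 *m L1^T = 0 -> L2 *m B2 *m L2^T = 0 ->
  exists S, S *m B2 *m S^T = B1.
Proof.
move=> K2 s1 s2 u1 u2 e1 e2.
have ek : k2 = k1 by apply: double_inj; rewrite -!addnn -e1 -e2.
subst k2; clear e2; subst m => f1 f2 i1 i2.
have [S1 h1] := hyperbolic_basis K2 s1 u1 f1 i1.
have [S2 h2] := hyperbolic_basis K2 s2 u2 f2 i2.
have u : S1 \in unitmx.
  have: block_mx 0 1%:M 1%:M 0 \in @unitmx K (k1 + k1).
    have /mulmx1_unit[] // : block_mx 0 1%:M 1%:M 0 *m block_mx 0 1%:M 1%:M 0 = 1%:M :> 'M[K]_(k1 + k1).
    by rewrite mulmx_block !(mulmx0, mul0mx, mulmx1, addr0, add0r) -scalar_mx_block.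
  by rewrite -h1 !unitmx_mul => /andP[/andP[]].
exists (invmx S1 *m S2).
rewrite trmx_mul !mulmxA -(mulmxA _ S2) -(mulmxA _ (S2 *m B2)) h2 -h1.
by rewrite !mulmxA mulVmx // mul1mx -mulmxA -trmx_mul mulVmx // trmx1 mulmx1.
Qed.

(** In a linear relation between the rows, a row [i] of least weight among those that
    occur is the only one with a nonzero entry in column [c i]. *)
Lemma twisted_triangular_unit (K : fieldType) m (B : 'M[K]_m) (c : 'I_m -> 'I_m)
    (w : 'I_m -> nat) :
  (forall i, B i (c i) != 0) ->
  (forall i j, B i (c j) != 0 -> i = j \/ (w i < w j)%N) -> B \in unitmx.
Proof.
move=> nz tri; rewrite -row_free_unit; apply/inj_row_free=> v vB.
apply/eqP; apply/negPn/negP=> /matrix0Pn[z [i0]]; rewrite (ord1 z) => vi0.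
have [i vi0' imin] := @arg_minnP _ i0 (fun i => v 0 i != 0) w vi0.
move/matrixP/(_ 0 (c i)): vB; rewrite !mxE (bigD1 i) //= big1 ?addr0.
  by move/eqP; rewrite mulf_eq0 (negPf vi0') (negPf (nz i)).
move=> j ji; apply/eqP; rewrite mulf_eq0; apply/norP=> -[vj /tri[e|]].
  by rewrite e eqxx in ji.
by rewrite ltnNge imin.
Qed.

(** * The trace form of a group algebra *)

Lemma half_card (T : finType) (p : pred T) (k : T -> T) :
  involutive k -> (forall x, p (k x) = ~~ p x) -> #|T| = (#|p| + #|p|)%N.
Proof.
move=> kK kp; rewrite -(cardC p); congr (_ + _)%N.
rewrite -(card_image (inv_inj kK) p); apply: eq_card => x; rewrite !inE.
rewrite -[x in RHS]kK (mem_image (inv_inj kK)) -kp //.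
Qed.

Definition selmx (K : fieldType) (T : finType) (p : {pred T}) : 'M[K]_(#|p|, #|T|) :=
  \matrix_(a, b) (enum_val b == enum_val a)%:R.

Lemma mul_selmx (K : fieldType) (T : finType) (p : {pred T}) m (A : 'M[K]_(#|T|, m)) a b :
  (selmx K p *m A) a b = A (enum_rank (enum_val a)) b.
Proof.
rewrite mxE (bigD1 (enum_rank (enum_val a))) //= big1 => [|c nc].
  by rewrite mxE enum_rankK eqxx mul1r addr0.
rewrite mxE; case: eqP => [e|_]; last by rewrite mul0r.
by rewrite -e enum_valK eqxx in nc.
Qed.

Lemma selmx_free (K : fieldType) (T : finType) (p : {pred T}) : row_free (selmx K p).
Proof.
apply/row_freeP; exists (selmx K p)^T; apply/matrixP=> a b.
by rewrite mul_selmx !mxE enum_rankK (inj_eq enum_val_inj).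
Qed.

Lemma selmx_congr (K : fieldType) (T : finType) (p : {pred T}) (A : 'M[K]_#|T|) a b :
  (selmx K p *m A *m (selmx K p)^T) a b =
  A (enum_rank (enum_val a)) (enum_rank (enum_val b)).
Proof.
rewrite -mulmxA mul_selmx -[A *m _]trmxK mxE trmx_mul trmxK mul_selmx mxE //.
Qed.

Section GroupInvolution.
Variables (gT : finGroupType) (tau : gT).
Hypotheses (tau2 : (tau * tau = 1)%g) (tau1 : tau != 1%g).

(** An involution without fixed point that preserves the set of elements of order at
    most two and exchanges each other element with its inverse. *)
Definition toggle (x : gT) : gT :=
  (if x^-1 == x then if x * tau == tau * x then x * tau else tau * x * tau
   else x^-1)%g.

Let tauV : (tau^-1 = tau)%g.
Proof. by apply/eqP; rewrite eq_invg_mul tau2. Qed.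

Lemma toggle_inv x : ((toggle x)^-1 == toggle x)%g = (x^-1 == x)%g.
Proof.
rewrite /toggle; case: ifP => [/eqP xV|nx].
  case: ifP => [/eqP c|_]; first by rewrite invMg xV tauV -c eqxx.
  by rewrite !invMg xV tauV mulgA eqxx.
by rewrite invgK eq_sym.
Qed.

Lemma toggleK : involutive toggle.
Proof.
move=> x; rewrite {1}/toggle toggle_inv; case: ifP => [xV|nx].
  have e y : (y * tau * tau = y)%g by rewrite -mulgA tau2 mulg1.
  rewrite /toggle xV; have [c|/eqP/negbTE nc] := (x * tau)%g =P (tau * x)%g.
    by rewrite e mulgA -c e eqxx.
  by rewrite e !mulgA tau2 mul1g eq_sym nc e.
by rewrite /toggle nx invgK.
Qed.

Lemma toggle_neq x : toggle x != x.
Proof.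
rewrite /toggle; case: ifP => [xV|->//]; case: ifP => [_|/negP nc].
  by apply: contra tau1 => /eqP e; rewrite -(inj_eq (mulgI x)) e mulg1.
by apply/eqP=> e; apply: nc; rewrite -{1}e -mulgA tau2 mulg1.
Qed.

End GroupInvolution.

Section InverseForm.
Variables (K : fieldType) (gT : finGroupType).

(** The Gram matrix, on the basis of group elements, of the trace form of the group
    algebra, for which the product of [x] and [y] is the coefficient of 1 in [x * y]. *)
Definition inv_form : 'M[K]_#|gT| :=
  \matrix_(i, j) (enum_val j == (enum_val i)^-1)%g%:R.

Lemma sum_enum_val (T : finType) (F : T -> K) :
  \sum_(j < #|T|) F (enum_val j) = \sum_t F t.
Proof. by rewrite [RHS](reindex _ (onW_bij _ (enum_val_bij T))). Qed.

Lemma inv_form_bilin (u v : gT -> K) :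
  \sum_(j < #|gT|) (\sum_(l < #|gT|) u (enum_val l) * inv_form l j) * v (enum_val j)
   = \sum_x u x * v (x^-1)%g.
Proof.
under eq_bigr => j _ do rewrite mulr_suml.
rewrite exchange_big /= -[RHS]sum_enum_val; apply: eq_bigr => l _.
rewrite (bigD1 (enum_rank ((enum_val l)^-1)%g)) //= big1 ?addr0 => [|j nj].
  by rewrite mxE enum_rankK eqxx mulr1.
rewrite mxE; case: eqP => [e|_]; last by rewrite mulr0 mul0r.
by rewrite -e enum_valK eqxx in nj.
Qed.

(** With [i] a square root of -1, take the vector [e_x] for one element of each pair of
    distinct mutually inverse elements, and [e_x + i e_y] for each pair [{x, y}] of
    elements of order at most two exchanged by [toggle]: its norm is [1 + i ^+ 2]. *)
Lemma inv_form_isotropic (tau : gT) (i : K) :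
  (tau * tau = 1)%g -> tau != 1%g -> i ^+ 2 = -1 ->
  exists k, exists L : 'M[K]_(k, #|gT|),
    [/\ #|gT| = (k + k)%N, row_free L & L *m inv_form *m L^T = 0].
Proof.
move=> t2 t1 i2; pose kap := toggle tau.
have kK : involutive kap := toggleK t2.
have kV x : ((kap x)^-1 == kap x)%g = (x^-1 == x)%g := toggle_inv t2 x.
have kN x : kap x != x := toggle_neq t2 t1 x.
(* one element in each orbit of [toggle] *)
pose p : pred gT := fun x => (enum_rank x < enum_rank (kap x))%N.
have pk x : p (kap x) = ~~ p x.
  rewrite /p kK -leqNgt [RHS]leq_eqVlt; case: eqP => //= e.
  by have := kN x; rewrite (enum_rank_inj (val_inj e)) eqxx.
pose c (x : gT) : K := if (x^-1 == x)%g then i else 0.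
pose u (x y : gT) : K := (y == x)%:R + c x * (y == kap x)%:R.
pose L : 'M[K]_(#|p|, #|gT|) := \matrix_(a, b) u (enum_val a) (enum_val b).
exists #|p|, L; split; first exact: half_card kK pk.
- apply/row_freeP; exists (\matrix_(b, a) (enum_val b == enum_val a)%:R).
  apply/matrixP=> a a'; rewrite !mxE.
  have pa' : p (enum_val a') by exact: (enum_valP a').
  have pa : p (enum_val a) by exact: (enum_valP a).
  rewrite (bigD1 (enum_rank (enum_val a'))) //= big1 => [|b nb].
    rewrite !mxE enum_rankK eqxx mulr1 addr0 /u.
    have -> : enum_val a' == kap (enum_val a) = false.
      by apply/eqP=> e; move: pa'; rewrite e pk pa.
    by rewrite mulr0 addr0 (inj_eq enum_val_inj) eq_sym.
  rewrite !mxE; case: eqP => [e|_]; last by rewrite mulr0.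
  by rewrite -e enum_valK eqxx in nb.
apply/matrixP=> a b; rewrite !mxE.
transitivity (\sum_(j < #|gT|) (\sum_(l < #|gT|) u (enum_val a) (enum_val l) * inv_form l j)
   * u (enum_val b) (enum_val j)).
  apply: eq_bigr => j _; rewrite !mxE; congr (_ * _).
  by apply: eq_bigr => l _; rewrite mxE.
rewrite inv_form_bilin.
have px : p (enum_val a) by exact: (enum_valP a).
have py : p (enum_val b) by exact: (enum_valP b).
move: (enum_val a) (enum_val b) px py => x y px py.
have uE (F : gT -> K) : \sum_z u x z * F z = F x + c x * F (kap x).
  rewrite (eq_bigr (fun z => (z == x)%:R * F z + c x * ((z == kap x)%:R * F z))); last first.
    by move=> z _; rewrite /u mulrDl mulrA.
  rewrite big_split /= -mulr_sumr; congr (_ + _ * _).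
    rewrite (bigD1 x) //= eqxx mul1r big1 ?addr0 // => z /negbTE->.
    by rewrite mul0r.
  rewrite (bigD1 (kap x)) //= eqxx mul1r big1 ?addr0 // => z /negbTE->.
  by rewrite mul0r.
rewrite uE /u /c.
have pn z z' : p z -> p z' -> z == kap z' = false.
  by move=> pz pz'; apply/eqP=> e; move: pz; rewrite e pk pz'.
have eqk : (kap x == kap y) = (x == y) by rewrite (inj_eq (inv_inj kK)).
have [xV|nx] := boolP (x^-1 == x)%g.
  have kxV : ((kap x)^-1 = kap x)%g by apply/eqP; rewrite kV.
  rewrite (eqP xV) kxV eqk (pn x y) // (eq_sym (kap x) y) (pn y x) //.
  case: (x =P y) => [<-|_]; last by rewrite !(mulr0, addr0).
  by rewrite xV !mulr0 !mulr1 add0r addr0 -expr2 i2 subrr.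
rewrite mul0r addr0.
have [yV|ny] := boolP (y^-1 == y)%g.
  have -> : (x^-1 == y)%g = false.
    by apply/negbTE; apply: contra nx => /eqP e; rewrite -[X in _ == X]invgK e eq_sym.
  have -> : (x^-1 == kap y)%g = false.
    apply/negbTE; apply: contra nx => /eqP e; rewrite -[X in _ == X]invgK e.
    by rewrite eq_sym kV.
  by rewrite mulr0 addr0.
rewrite mul0r addr0; have -> : (x^-1 == y)%g = false; last by [].
have := pn y x py px; rewrite /kap /toggle (negbTE nx) eq_sym => <- //.
Qed.

End InverseForm.

(** * Gram matrices of plane and special plane posets *)

Section Gram.
Variables (K : fieldType) (n : nat).
Implicit Types r s t : 'S_n.

Definition gramP : 'M[K]_#|'S_n| :=
  \matrix_(i, j) (npictures (pposet (enum_val i)) (pposet (enum_val j)))%:R.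
Definition gramS : 'M[K]_#|'S_n| :=
  \matrix_(i, j) (npictures (sposet (enum_val i)) (sposet (enum_val j)))%:R.
Definition linext_mx : 'M[K]_#|'S_n| :=
  \matrix_(i, j) (linext (enum_val i) (enum_val j))%:R.

Lemma gramP_sym : gramP^T = gramP.
Proof. by apply/matrixP=> i j; rewrite !mxE npictures_sym. Qed.

Lemma gramS_sym : gramS^T = gramS.
Proof. by apply/matrixP=> i j; rewrite !mxE npictures_sym. Qed.

Lemma natr_neq0 m : m%:R != 0 :> K -> m != 0%N.
Proof. by apply: contraNneq => ->. Qed.

Lemma gramP_unit : gramP \in unitmx.
Proof.
apply: (@twisted_triangular_unit _ _ _ (fun i => enum_rank (rev_perm (enum_val i)))
         (fun i => #|asc (enum_val i)|)) => [i|i j]; rewrite mxE enum_rankK.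
  by rewrite npictures_rev oner_eq0.
by move/natr_neq0/npictures_rev_neq0 => [/enum_val_inj|]; [left | right].
Qed.

Lemma linext_mx_unit : linext_mx \in unitmx.
Proof.
apply: (@twisted_triangular_unit _ _ _ id (fun i => #|asc (enum_val i)|)) => [i|i j]; rewrite mxE.
  by rewrite linext_refl oner_eq0.
case e: linext; last by rewrite eqxx.
by move: e => /linext_asc[/enum_val_inj|]; [left | right].
Qed.

(** [linext_mx] expresses special plane posets through their linear extensions, and
    turns the pairing into the trace form of the group algebra, which is the pairing
    of free quasi-symmetric functions. *)
Lemma gramS_factor : gramS = linext_mx *m inv_form K 'S_n *m linext_mx^T.
Proof.
apply/matrixP=> i j; rewrite !mxE npictures_special natr_sum.
have := inv_form_bilin (fun t => (linext (enum_val i) t)%:R : K)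
                       (fun t => (linext (enum_val j) t)%:R : K).
under [RHS]eq_bigr => t _ do rewrite -natrM.
move=> <-; apply: eq_bigr => k _; rewrite !mxE; congr (_ * _).
by apply: eq_bigr => l _; rewrite [linext_mx _ _]mxE.
Qed.

Lemma gramS_unit : gramS \in unitmx.
Proof.
rewrite gramS_factor !unitmx_mul unitmx_tr linext_mx_unit andbT /=.
apply: (@twisted_triangular_unit _ _ _ (fun i => enum_rank (enum_val i)^-1%g)
         (fun=> 0%N)) => [i|i j].
  by rewrite mxE enum_rankK eqxx oner_eq0.
rewrite mxE enum_rankK (inj_eq invg_inj).
case: (enum_val j =P enum_val i) => [/enum_val_inj->|_]; first by left.
by rewrite eqxx.
Qed.

(** Both Gram matrices are invertible, and both forms have a totally isotropic subspace
    of half the dimension: spanned by the upper plane posets on one side, transported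
    from the trace form of the symmetric group on the other. In degree at most one
    there is a single permutation and the matrices coincide. *)
Lemma gram_congruent (i : K) : (2 : K) != 0 -> i ^+ 2 = -1 ->
  exists S, S *m gramS *m S^T = gramP.
Proof.
move=> K2 i2; have [n1|n1] := leqP n 1.
  have c1 : #|'S_n| = 1%N by rewrite card_Sn; case: n n1 => [|[]].
  exists 1%:M; rewrite mul1mx trmx1 mulmx1; apply/matrixP=> a b; rewrite !mxE.
  congr (_%:R); move: (enum_val a) (enum_val b) => r s; apply: eq_card => f; rewrite !inE.
  have e (u v : 'I_n) : u = v.
    by apply: val_inj; case: u v => u /= hu [v /= hv]; lia.
  by congr andb; apply/picturebP/picturebP => _ x y;
     rewrite (e y x) !le1_refl !le2_refl.
pose tau : 'S_n := tperm (Ordinal (ltnW n1)) (Ordinal n1).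
have t2 : (tau * tau = 1)%g by rewrite tperm2.
have t1 : tau != 1%g.
  by apply/eqP=> /permP/(_ (Ordinal (ltnW n1))); rewrite tpermL perm1.
have [k [L [ek Lf L0]]] := inv_form_isotropic t2 t1 i2.
have U0 : selmx K (@upper n) *m gramP *m (selmx K (@upper n))^T = 0.
  apply/matrixP=> a b; rewrite selmx_congr !mxE !enum_rankK npictures_upper //.
    exact: (enum_valP a).
  exact: (enum_valP b).
have eU : #|'S_n| = (#|@upper n| + #|@upper n|)%N.
  apply: (half_card (@rev_permK n)) => r; exact: upper_rev.
have Eu := linext_mx_unit.
apply: (hyperbolic_congruent K2 gramP_sym gramS_sym gramP_unit gramS_unit eU ek (selmx_free _ _) _ U0
          (L2 := L *m invmx linext_mx)).
  by rewrite /row_free mxrankMfree // row_free_unit unitmx_inv.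
rewrite gramS_factor !mulmxA mulmxKV // trmx_mul !mulmxA -(mulmxA _ linext_mx^T) -trmx_mul.
by rewrite mulVmx // trmx1 mulmx1.
Qed.

End Gram.

(** * Linear extension from the basis *)

Section LinearExtension.
Variables (K : fieldType) (T : choiceType) (V : lmodType K).
Implicit Types (f g : T -> V) (a : {malg K[T]}).

Definition lext f a : V := \sum_(p <- msupp a) a@_p *: f p.

Lemma lextEw f (d : {fset T}) a : {subset msupp a <= d} ->
  lext f a = \sum_(p <- d) a@_p *: f p.
Proof.
move=> sd; rewrite /lext; apply: big_fset_incl; first exact/fsubsetP.
by move=> x _ /mcoeff_outdom ->; rewrite scale0r.
Qed.

Lemma lext_is_linear f : linear (lext f).
Proof.
move=> c a b; pose d := (msupp a `|` msupp b)%fset.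
have da : {subset msupp a <= d} by move=> x xa; rewrite in_fsetU xa.
have db : {subset msupp b <= d} by move=> x xa; rewrite in_fsetU xa orbT.
have dc : {subset msupp (c *: a + b) <= d}.
  move=> x; rewrite -mcoeff_neq0 mcoeffD mcoeffZ in_fsetU -!mcoeff_neq0 => nz.
  have [a0|//] := eqVneq (a@_x) 0; apply/orP; right.
  by apply: contraNneq nz => ->; rewrite a0 mulr0 addr0.
rewrite (lextEw _ da) (lextEw _ db) (lextEw _ dc) scaler_sumr -big_split /=.
by apply: eq_bigr => p _; rewrite mcoeffD mcoeffZ scalerDl scalerA.
Qed.

HB.instance Definition _ f :=
  GRing.isLinear.Build K {malg K[T]} V *:%R (lext f) (lext_is_linear f).

Lemma lextU f p : lext f << p >> = f p.
Proof.
rewrite (@lextEw _ [fset p]%fset) ?big_seq_fset1 ?mcoeffUU ?scale1r // => x.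
rewrite -mcoeff_neq0 mcoeffU in_fset1.
by case: (p =P x) => [->|_]; rewrite ?eqxx.
Qed.

Lemma malg_sum a : a = \sum_(p <- msupp a) a@_p *: << p >>.
Proof.
rewrite [LHS]monalgE; apply: eq_bigr => p _; apply/malgP=> q.
by rewrite mcoeffZ !mcoeffU; case: eqP => _; rewrite ?mulr1 ?mulr0.
Qed.

Lemma eq_lext f g a : (forall p, a@_p != 0 -> f p = g p) -> lext f a = lext g a.
Proof.
move=> e; rewrite /lext !big_seq; apply: eq_bigr => p.
by rewrite -mcoeff_neq0 => /e ->.
Qed.

Lemma linear_lext (L : {malg K[T]} -> V) : linear L ->
  forall a, L a = lext (fun p => L << p >>) a.
Proof.
move=> lL a; pose L' : {linear {malg K[T]} -> V} := HB.pack L (GRing.isLinear.Build _ _ _ _ L lL).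
have -> : L a = L' a by [].
by rewrite {1}(malg_sum a) linear_sum /lext; apply: eq_bigr => p _; rewrite linearZ.
Qed.

Lemma linear_eq (L M : {malg K[T]} -> V) a : linear L -> linear M ->
  (forall p, a@_p != 0 -> L << p >> = M << p >>) -> L a = M a.
Proof.
by move=> lL lM e; rewrite (linear_lext lL) (linear_lext lM); apply: eq_lext.
Qed.

End LinearExtension.

(** * The Hopf pairing *)

Section Structure.
Variable K : fieldType.
Implicit Types (a b c d : HDP K) (x y z : isoclass) (t u : HDP2 K).

Definition npic x y : nat := npictures (rep x) (rep y).

Lemma npic_cls (T U : finType) (P : dposet T) (Q : dposet U) :
  npic (cls P) (cls Q) = npictures P Q.
Proof. exact: npictures_diso (diso_rep _) (diso_rep _). Qed.

Lemma npic_sym x y : npic x y = npic y x.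
Proof. exact: npictures_sym. Qed.

Lemma npic_crd x y : crd x != crd y -> npic x y = 0%N.
Proof.
by move=> ne; apply/eqP; apply: contraNT ne => /npictures_crd; rewrite !card_ord => ->.
Qed.

Lemma pairing_lext a b :
  pairing a b = lext (fun x => lext (fun y => (npic x y)%:R : K^o) b : K^o) a.
Proof.
rewrite /pairing /lext; apply: eq_bigr => p _; rewrite [RHS]mulr_sumr.
by apply: eq_bigr => q _; rewrite -mulrA.
Qed.

Lemma pairing_linl b : linear (fun a => pairing a b : K^o).
Proof. by move=> s a a'; rewrite !pairing_lext linearP. Qed.

Lemma pairing_sym a b : pairing a b = pairing b a.
Proof.
rewrite /pairing exchange_big /=; apply: eq_bigr => q _; apply: eq_bigr => p _.
by rewrite -/(npic _ _) npic_sym [_@_p * _]mulrC.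
Qed.

Lemma pairing_linr a : linear (fun b => pairing a b : K^o).
Proof. by move=> s b b'; rewrite !(pairing_sym a) pairing_linl. Qed.

Lemma pairing_basis x y : pairing << x >> << y >> = (npic x y)%:R :> K.
Proof. by rewrite pairing_lext !lextU. Qed.

Lemma tens_lext a b :
  tens a b = lext (fun x => lext (fun y => << (x, y) >> : HDP2 K) b) a.
Proof.
rewrite /tens /lext; apply: eq_bigr => p _; rewrite scaler_sumr.
apply: eq_bigr => q _; apply/malgP=> k.
by rewrite !mcoeffZ !mcoeffU; case: eqP => _; rewrite ?mulr1 ?mulr0.
Qed.

Lemma tens_linl b : linear (fun a => tens a b).
Proof. by move=> s a a'; rewrite !tens_lext linearP. Qed.

Lemma tens_linr a : linear (fun b => tens a b).
Proof.
move=> s b b'; rewrite !tens_lext /lext scaler_sumr -big_split /=.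
by apply: eq_bigr => p _; rewrite -/(lext _ _) linearP scalerDr !scalerA mulrC.
Qed.

Lemma tens_basis x y : tens << x >> << y >> = << (x, y) >> :> HDP2 K.
Proof. by rewrite tens_lext !lextU. Qed.

Lemma coprod_lin : linear (@coprod K).
Proof. exact: (@lext_is_linear _ _ _ (fun x => dpcoprod K (rep x))). Qed.

Lemma coprod_basis x : coprod << x >> =
  \sum_(I : {set 'I_(crd x)} | upset (rep x) I)
     << (csub (rep x) (~: I), csub (rep x) I) >> :> HDP2 K.
Proof. exact: (@lextU _ _ _ (fun x => dpcoprod K (rep x))). Qed.

Definition pair2 a b t : K :=
  lext (fun k => pairing a << k.1 >> * pairing b << k.2 >> : K^o) t.

Lemma pair2_lin a b : linear (fun t => pair2 a b t : K^o).
Proof. exact: lext_is_linear. Qed.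

Lemma pair2_linl b t : linear (fun a => pair2 a b t : K^o).
Proof.
move=> s a a'; rewrite /pair2 /lext scaler_sumr -big_split /=.
apply: eq_bigr => k _; rewrite (pairing_linl _ s a a') /=.
by rewrite /GRing.scale /=; ring.
Qed.

Lemma pair2_linr a t : linear (fun b => pair2 a b t : K^o).
Proof.
move=> s b b'; rewrite /pair2 /lext scaler_sumr -big_split /=.
apply: eq_bigr => k _; rewrite (pairing_linl _ s b b') /=.
by rewrite /GRing.scale /=; ring.
Qed.

Lemma pair2_tens a b c d : pair2 a b (tens c d) = pairing a c * pairing b d.
Proof.
have l1 : linear (fun c => pair2 a b (tens c d) : K^o).
  by move=> s c1 c2; rewrite tens_linl pair2_lin.
have l2 : linear (fun c => pairing a c * pairing b d : K^o).
  by move=> s c1 c2; rewrite pairing_linr /GRing.scale /=; ring.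
apply: (linear_eq (a := c) l1 l2) => x _.
have l3 : linear (fun d => pair2 a b (tens << x >> d) : K^o).
  by move=> s c1 c2; rewrite tens_linr pair2_lin.
have l4 : linear (fun d => pairing a << x >> * pairing b d : K^o).
  by move=> s c1 c2; rewrite pairing_linr /GRing.scale /=; ring.
apply: (linear_eq (a := d) l3 l4) => y _.
by rewrite tens_basis /pair2 lextU.
Qed.

Lemma malg_scaleAr s a b : a * (s *: b) = s *: (a * b).
Proof.
apply/malgP=> k; rewrite mcoeffZ (mcoeffMlw _ (fsubset_refl _) (msuppZ_le s b)) mcoeffMl.
rewrite mulr_sumr; apply: eq_bigr => k1 _; rewrite mulr_sumr; apply: eq_bigr => k2 _.
by rewrite mcoeffZ mulrnAr mulrCA.
Qed.

Lemma mul_basis x y : << x >> * << y >> = << cmul x y >> :> HDP K.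
Proof. by rewrite malgM_def fgmulUU mulr1. Qed.

Lemma npic_mul x y z : (npic (cmul x y) z)%:R =
  \sum_(I : {set 'I_(crd z)} | upset (rep z) I)
     (npic x (csub (rep z) (~: I)))%:R * (npic y (csub (rep z) I))%:R :> K.
Proof.
rewrite -[z in LHS]repK /cmul npic_cls npictures_mul natr_sum.
apply: eq_bigr => I _; rewrite natrM -(npictures_diso (diso_refl _) (diso_rep _)).
by rewrite -(npictures_diso (diso_refl _) (diso_rep (dpsub (rep z) I))).
Qed.

(** By linearity this is [npictures_mul]. *)
Lemma pairing_mul a b c : pairing (a * b) c = pair2 a b (coprod c).
Proof.
have l1 : linear (fun a => pairing (a * b) c : K^o).
  by move=> s a1 a2; rewrite mulrDl -scalerAl pairing_linl.
have l2 := pair2_linl b (coprod c).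
apply: (linear_eq (a := a) l1 l2) => x _.
have l3 : linear (fun b => pairing (<< x >> * b) c : K^o).
  by move=> s b1 b2; rewrite mulrDr malg_scaleAr pairing_linl.
have l4 := pair2_linr << x >> (coprod c).
apply: (linear_eq (a := b) l3 l4) => y _.
have l6 : linear (fun c => pair2 << x >> << y >> (coprod c) : K^o).
  by move=> s c1 c2; rewrite coprod_lin pair2_lin.
apply: (linear_eq (a := c) (pairing_linr _) l6) => z _.
rewrite mul_basis pairing_basis npic_mul coprod_basis /pair2 linear_sum /=.
by apply: eq_bigr => I _; rewrite lextU !pairing_basis.
Qed.

Definition tmul t u : HDP2 K :=
  lext (fun k => lext (fun l => << (cmul k.1 l.1, cmul k.2 l.2) >> : HDP2 K) u) t.

Lemma tmul_linl u : linear (fun t => tmul t u).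
Proof. exact: lext_is_linear. Qed.

Lemma tmul_linr t : linear (fun u => tmul t u).
Proof.
move=> s u u'; rewrite /tmul /lext scaler_sumr -big_split /=.
by apply: eq_bigr => p _; rewrite -/(lext _ _) linearP scalerDr !scalerA mulrC.
Qed.

Lemma mul_linl b : linear (fun a : HDP K => a * b).
Proof. by move=> s a a'; rewrite mulrDl -scalerAl. Qed.

Lemma mul_linr a : linear (fun b : HDP K => a * b).
Proof. by move=> s b b'; rewrite mulrDr malg_scaleAr. Qed.

Lemma comp_lin (U V W : lmodType K) (f : V -> W) (g : U -> V) :
  linear f -> linear g -> linear (fun v => f (g v)).
Proof. by move=> lf lg s x y; rewrite lg lf. Qed.

Lemma tmul_tens a b c d : tmul (tens a b) (tens c d) = tens (a * c) (b * d).
Proof.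
have l1 := comp_lin (tmul_linl (tens c d)) (tens_linl b).
apply: (linear_eq (a := a) l1 (comp_lin (tens_linl (b * d)) (mul_linl c))) => x _.
have l2 := comp_lin (tmul_linl (tens c d)) (tens_linr << x >>).
apply: (linear_eq (a := b) l2 (comp_lin (tens_linr _) (mul_linl d))) => y _.
have l3 := comp_lin (tmul_linr (tens << x >> << y >>)) (tens_linl d).
apply: (linear_eq (a := c) l3 (comp_lin (tens_linl _) (mul_linr << x >>))) => z _.
have l4 := comp_lin (tmul_linr (tens << x >> << y >>)) (tens_linr << z >>).
apply: (linear_eq (a := d) l4 (comp_lin (tens_linr _) (mul_linr << y >>))) => w _.
by rewrite !mul_basis !tens_basis /tmul !lextU.
Qed.

(** No relation of the first order links the two parts of a product. *)
Lemma upset_mul (T U : finType) (P : dposet T) (Q : dposet U) (A : {set T}) (B : {set U}) :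
  upset (dpmul P Q) (inl @: A :|: inr @: B) = upset P A && upset Q B.
Proof.
have inlE (t : T) : (inl t \in inl @: A :|: inr @: B) = (t \in A).
  rewrite inE mem_imset ?orbF; last by move=> ? ? [].
  by case: imsetP => [[]//|_]; rewrite orbF.
have inrE (t : U) : (inr t \in inl @: A :|: inr @: B) = (t \in B).
  rewrite inE orbC mem_imset; last by move=> ? ? [].
  by case: imsetP => [[]//|_]; rewrite orbF.
apply/forallP/andP => [h|[/forallP hA /forallP hB]].
  split; apply/forallP=> x; apply/forallP=> y.
    by have /forallP/(_ (inl y)) := h (inl x); rewrite !inlE le1_mul.
  by have /forallP/(_ (inr y)) := h (inr x); rewrite !inrE le1_mul.
move=> [x|x]; apply/forallP=> -[y|y]; rewrite ?inlE ?inrE le1_mul /= ?andbF //.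
  by have /forallP/(_ y) := hA x.
by have /forallP/(_ y) := hB x.
Qed.

Lemma coprodM_basis x y :
  coprod (<< x >> * << y >>) = tmul (coprod << x >>) (coprod << y >>) :> HDP2 K.
Proof.
rewrite mul_basis /cmul coprodU /dpcoprod.
pose h (AB : {set 'I_(crd x)} * {set 'I_(crd y)}) : {set 'I_(crd x) + 'I_(crd y)} :=
  inl @: AB.1 :|: inr @: AB.2.
pose h' (S : {set 'I_(crd x) + 'I_(crd y)}) : {set 'I_(crd x)} * {set 'I_(crd y)} :=
  (inl @^-1: S, inr @^-1: S).
have memh A B (s : 'I_(crd x) + 'I_(crd y)) :
    (s \in h (A, B)) = match s with inl t => t \in A | inr t => t \in B end.
  case: s => t; rewrite inE /=.
    rewrite mem_imset; last by move=> ? ? [].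
    by case: imsetP => [[]//|_]; rewrite orbF.
  rewrite orbC mem_imset; last by move=> ? ? [].
  by case: imsetP => [[]//|_]; rewrite orbF.
have hK : cancel h h'.
  by case=> A B; congr pair; apply/setP=> t; rewrite inE memh.
have h'K : cancel h' h.
  by move=> S; apply/setP=> -[t|t]; rewrite memh inE.
have hC A B : ~: h (A, B) = h (~: A, ~: B).
  by apply/setP=> -[t|t]; rewrite inE !memh inE.
rewrite (reindex h) /=; last by exists h' => S _.
rewrite (eq_bigl (fun AB => upset (rep x) AB.1 && upset (rep y) AB.2)); last first.
  by case=> A B; rewrite upset_mul.
rewrite !coprod_basis -(pair_big (upset (rep x)) (upset (rep y))
  (fun A B => << (csub (dpmul (rep x) (rep y)) (~: h (A, B)), csub (dpmul (rep x) (rep y)) (h (A, B))) >>)).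
rewrite /tmul linear_sum; apply: eq_bigr => A _; rewrite /= lextU linear_sum /=.
by apply: eq_bigr => B _; rewrite lextU hC !csub_mul.
Qed.

Lemma coprodM a b : coprod (a * b) = tmul (coprod a) (coprod b).
Proof.
have l1 := comp_lin coprod_lin (mul_linl b).
apply: (linear_eq (a := a) l1 (comp_lin (tmul_linl _) coprod_lin)) => x _.
have l2 := comp_lin coprod_lin (mul_linr << x >>).
apply: (linear_eq (a := b) l2 (comp_lin (tmul_linr _) coprod_lin)) => y _.
exact: coprodM_basis.
Qed.

End Structure.

(** * Homogeneous components *)

Definition planec (x : isoclass) := plane (rep x).
Definition specialc (x : isoclass) := special_plane (rep x).
Definition pcl n (r : 'S_n) : isoclass := cls (pposet r).
Definition scl n (r : 'S_n) : isoclass := cls (sposet r).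

Lemma crd_pcl n (r : 'S_n) : crd (pcl r) = n.
Proof. by rewrite crd_cls card_ord. Qed.
Lemma crd_scl n (r : 'S_n) : crd (scl r) = n.
Proof. by rewrite crd_cls card_ord. Qed.
Lemma planec_pcl n (r : 'S_n) : planec (pcl r).
Proof. exact: plane_diso (diso_rep _) (plane_p r). Qed.
Lemma specialc_scl n (r : 'S_n) : specialc (scl r).
Proof. exact: special_diso (diso_rep _) (special_s r). Qed.

Lemma planec_perm n x : planec x -> crd x = n -> exists r : 'S_n, x = pcl r.
Proof.
move=> px <-; have := plane_perm px; rewrite card_ord => -[r /clsP e].
by exists r; rewrite -[LHS]repK -e.
Qed.

Lemma specialc_perm n x : specialc x -> crd x = n -> exists r : 'S_n, x = scl r.
Proof.
move=> px <-; have := special_perm px; rewrite card_ord => -[r /clsP e].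
by exists r; rewrite -[LHS]repK -e.
Qed.

Lemma pcl_inj n : injective (@pcl n).
Proof. by move=> r s /clsP/pposet_inj. Qed.
Lemma scl_inj n : injective (@scl n).
Proof. by move=> r s /clsP/sposet_inj. Qed.

Lemma planecM x y : planec x -> planec y -> planec (cmul x y).
Proof. exact: plane_repM. Qed.
Lemma specialcM x y : specialc x -> specialc y -> specialc (cmul x y).
Proof. exact: special_repM. Qed.
Lemma planec_csub x (I : {set 'I_(crd x)}) : planec x -> planec (csub (rep x) I).
Proof. exact: plane_repS. Qed.
Lemma specialc_csub x (I : {set 'I_(crd x)}) : specialc x -> specialc (csub (rep x) I).
Proof. exact: special_repS. Qed.

Lemma planecM_inv x y : planec (cmul x y) -> planec x /\ planec y.
Proof.
move exy: (cmul x y) => z pz.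
by have [A [_ -> ->]] := cut_of_mul (esym exy); split; apply: planec_csub.
Qed.

Section Homogeneous.
Variable K : fieldType.
Implicit Types (a b c d : HDP K) (x y z : isoclass) (t u : HDP2 K).

(** Homogeneous elements of degree [n] in the span of special plane posets. The
    condition bears on coefficients, which is convenient for products and tensors. *)
Definition inS n a : Prop := forall q, a@_q != 0 -> specialc q /\ crd q = n.

Lemma inS_lin n s a b : inS n a -> inS n b -> inS n (s *: a + b).
Proof.
move=> ha hb q; rewrite mcoeffD mcoeffZ; have [a0|/ha //] := eqVneq (a@_q) 0.
by rewrite a0 mulr0 add0r => /hb.
Qed.

Lemma inS0 n : inS n 0. Proof. by move=> q; rewrite mcoeff0 eqxx. Qed.

Lemma inS_sum n (I : Type) (r : seq I) (P : pred I) (F : I -> HDP K) :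
  (forall i, P i -> inS n (F i)) -> inS n (\sum_(i <- r | P i) F i).
Proof.
move=> h; elim/big_ind: _ => //; first exact: inS0.
by move=> a b ha hb; rewrite -[a]scale1r; apply: inS_lin.
Qed.

Lemma inSZ n s a : inS n a -> inS n (s *: a).
Proof. by move=> ha; rewrite -[_ *: _]addr0; apply: inS_lin => //; apply: inS0. Qed.

Lemma inSU q : specialc q -> inS (crd q) << q >>.
Proof. by move=> sq x; rewrite mcoeffU; case: (q =P x) => [<-|]; rewrite ?eqxx. Qed.

Lemma inS_scl n (r : 'S_n) : inS n << scl r >>.
Proof. by rewrite -{1}(crd_scl r); apply/inSU/specialc_scl. Qed.

Lemma inSM k l a b : inS k a -> inS l b -> inS (k + l) (a * b).
Proof.
move=> ha hb q; rewrite mcoeff_neq0 => /msuppM_le[k1 [k2 [k1a k2b ->]]].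
rewrite -mcoeff_neq0 in k1a; rewrite -mcoeff_neq0 in k2b.
have [s1 <-] := ha _ k1a; have [s2 <-] := hb _ k2b.
by split; [apply: specialcM | apply: crd_mul].
Qed.

Definition ofS n (v : 'rV[K]_#|'S_n|) : HDP K := \sum_j v 0 j *: << scl (enum_val j) >>.
Definition vecS n a : 'rV[K]_#|'S_n| := \row_j a@_(scl (enum_val j)).

Lemma vecS_is_linear n : linear (@vecS n).
Proof. by move=> s a b; apply/rowP=> j; rewrite !mxE mcoeffD mcoeffZ. Qed.
HB.instance Definition _ n :=
  GRing.isLinear.Build K (HDP K) _ *:%R (@vecS n) (@vecS_is_linear n).

Lemma ofS_is_linear n : linear (@ofS n).
Proof.
move=> s a b; rewrite /ofS scaler_sumr -big_split; apply: eq_bigr => j _ /=.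
by rewrite !mxE scalerDl scalerA.
Qed.
HB.instance Definition _ n :=
  GRing.isLinear.Build K 'rV[K]_#|'S_n| (HDP K) *:%R (@ofS n) (@ofS_is_linear n).

Lemma inS_ofS n (v : 'rV_#|'S_n|) : inS n (ofS v).
Proof. by apply: inS_sum => j _; apply/inSZ/inS_scl. Qed.

Lemma ofSK n : cancel (@ofS n) (@vecS n).
Proof.
move=> v; apply/rowP=> j; rewrite mxE /ofS raddf_sum /= (bigD1 j) //= big1 => [|i nij].
  by rewrite mcoeffZ mcoeffUU mulr1 addr0.
rewrite mcoeffZ mcoeffU (inj_eq (@scl_inj n)) (inj_eq enum_val_inj) (negPf nij).
by rewrite mulr0.
Qed.

Lemma vecSK n a : inS n a -> ofS (vecS n a) = a.
Proof.
move=> ha; apply/malgP=> q; rewrite /ofS raddf_sum /=.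
have [aq|/ha[sq eq]] := eqVneq (a@_q) 0.
  rewrite aq big1 // => j _; rewrite mcoeffZ mcoeffU mxE.
  by case: eqP => [->|_]; rewrite ?aq ?mul0r ?mulr0.
have [r ->] := specialc_perm sq eq.
rewrite (bigD1 (enum_rank r)) //= big1 => [|i nij].
  by rewrite mxE mcoeffZ enum_rankK mcoeffUU mulr1 addr0.
rewrite mcoeffZ mcoeffU (inj_eq (@scl_inj n)); case: eqP => [e|_]; last by rewrite mulr0.
by rewrite -e enum_valK eqxx in nij.
Qed.

Lemma ofS_delta n (r : 'S_n) : ofS (delta_mx 0 (enum_rank r)) = << scl r >>.
Proof.
rewrite /ofS (bigD1 (enum_rank r)) //= big1 => [|i nij].
  by rewrite mxE !eqxx enum_rankK scale1r addr0.
by rewrite mxE (negPf nij) andbF scale0r.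
Qed.

Lemma pairing_suml (I : Type) (r : seq I) (P : pred I) (F : I -> HDP K) b :
  pairing (\sum_(i <- r | P i) F i) b = \sum_(i <- r | P i) pairing (F i) b.
Proof.
elim/big_rec2: _ => [|i y1 y2 _ <-].
  by rewrite /pairing msupp0 big_seq_fset0.
by rewrite -[F i in LHS]scale1r pairing_linl [_ *: _]mul1r.
Qed.

Lemma pairingZl s a b : pairing (s *: a) b = s * pairing a b.
Proof.
have := pairing_linl b s a 0; rewrite addr0 => ->.
by rewrite {2}/pairing msupp0 big_seq_fset0 addr0.
Qed.

Lemma pairingZr s a b : pairing a (s *: b) = s * pairing a b.
Proof. by rewrite pairing_sym pairingZl pairing_sym. Qed.

Lemma pairing_sumr (I : Type) (r : seq I) (P : pred I) (F : I -> HDP K) a :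
  pairing a (\sum_(i <- r | P i) F i) = \sum_(i <- r | P i) pairing a (F i).
Proof.
by rewrite pairing_sym pairing_suml; apply: eq_bigr => i _; apply: pairing_sym.
Qed.

Lemma pairing_ofS n (u v : 'rV_#|'S_n|) : pairing (ofS u) (ofS v) = bform (gramS K n) u v.
Proof.
rewrite /bform mxE /ofS pairing_sumr; apply: eq_bigr => j _.
rewrite pairingZr pairing_suml mulrC [v^T j 0]mxE [X in _ = X * _]mxE; congr (_ * _).
by apply: eq_bigr => i _; rewrite pairingZl pairing_basis npic_cls [gramS _ _ _ _]mxE.
Qed.

Lemma pairing_crd0 k l a b : inS k a -> inS l b -> k != l -> pairing a b = 0.
Proof.
move=> ha hb nkl; rewrite pairing_lext /lext big_seq big1 // => p.
rewrite -mcoeff_neq0 => /ha[_ pk]; rewrite big_seq big1 ?scaler0 // => q.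
rewrite -mcoeff_neq0 => /hb[_ ql].
by rewrite npic_crd ?scaler0 // pk ql.
Qed.

(** The inverse of the Gram matrix gives the dual basis. *)
Lemma dualS n (s : 'S_n) : exists v : 'rV[K]_#|'S_n|, forall q, specialc q ->
  pairing (ofS v) << q >> = (q == scl s)%:R.
Proof.
exists (delta_mx 0 (enum_rank s) *m invmx (gramS K n)) => q sq.
have [e|ne] := eqVneq (crd q) n; last first.
  rewrite (pairing_crd0 (@inS_ofS n _) (inSU sq)); last by rewrite eq_sym.
  by case: (q =P scl s) ne => [->|//]; rewrite crd_scl eqxx.
have [r ->] := specialc_perm sq e.
rewrite -(ofS_delta r) pairing_ofS /bform mulmxKV ?gramS_unit //.
by rewrite trmx_delta -colE !mxE eqxx (inj_eq (@scl_inj n)) (inj_eq enum_rank_inj).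
Qed.

(** Pairing with two elements of the dual basis extracts a coefficient. *)
Lemma nondegenerate2 N t :
  (forall k, t@_k != 0 -> [/\ specialc k.1, specialc k.2 & (crd k.1 + crd k.2)%N = N]) ->
  (forall p q, specialc p -> specialc q -> (crd p + crd q)%N = N ->
     pair2 << p >> << q >> t = 0) -> t = 0.
Proof.
move=> ht h; apply/malgP=> -[p q]; rewrite mcoeff0; apply/eqP/negPn/negP=> nz.
have [/= sp sq e] := ht _ nz.
have [r er] := specialc_perm sp erefl; have [s es] := specialc_perm sq erefl.
have [v dv] := dualS r; have [w dw] := dualS s.
have : pair2 (ofS v) (ofS w) t = t@_(p, q).
  rewrite /pair2 (eq_lext (g := fun k => ((k == (p, q))%:R : K^o))).
    have l : linear (fun t : HDP2 K => t@_(p, q) : K^o).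
      by move=> c x y; rewrite mcoeffD mcoeffZ.
    apply: etrans (esym (linear_lext l t)); apply: eq_lext => k _.
    by rewrite mcoeffU eq_sym.
  move=> k /ht[s1 s2 _]; rewrite dv // dw // -er -es -natrM mulnb.
  by case: k s1 s2 => k1 k2 s1 s2; rewrite xpair_eqE.
suff -> : pair2 (ofS v) (ofS w) t = 0 by move=> t0; rewrite -t0 eqxx in nz.
rewrite (linear_lext (pair2_linl (ofS w) t)) /lext big_seq big1 // => x.
rewrite -mcoeff_neq0 => /inS_ofS[sx cx].
rewrite (linear_lext (pair2_linr << x >> t)) /lext big_seq big1 ?scaler0 // => y.
rewrite -mcoeff_neq0 => /inS_ofS[sy cy].
by rewrite h ?scaler0 // cx cy.
Qed.

End Homogeneous.

(** * Isometries defined in small degrees *)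

Section IsometryBelow.
Variable K : fieldType.
Implicit Types (a b c d : HDP K) (x y z : isoclass) (t u : HDP2 K) (f g : isoclass -> HDP K).

Definition tmap f t : HDP2 K := lext (fun k => tens (f k.1) (f k.2)) t.

(** A map on the basis that behaves, in degrees less than [N], as an isometric
    morphism of Hopf algebras from the span of plane posets onto the span of special
    plane posets. *)
Record isometry_below N f : Prop := IsometryBelow {
  good1 : f cone = 1;
  goodM : forall x y, planec x -> planec y -> (crd x + crd y < N)%N ->
    f (cmul x y) = f x * f y;
  goodS : forall x, planec x -> (crd x < N)%N -> inS (crd x) (f x);
  goodP : forall x y, planec x -> planec y -> (crd x < N)%N -> (crd y < N)%N ->
    pairing (f x) (f y) = (npic x y)%:R;
  goodC : forall x, planec x -> (crd x < N)%N -> coprod (f x) = tmap f (coprod << x >>);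
  goodO : forall n (s : 'S_n), (n < N)%N ->
    exists c : 'S_n -> K, << scl s >> = \sum_(r : 'S_n) c r *: f (pcl r)
}.

Lemma tmap_coprod f x : tmap f (coprod << x >>) =
  \sum_(I : {set 'I_(crd x)} | upset (rep x) I)
     tens (f (csub (rep x) (~: I))) (f (csub (rep x) I)).
Proof.
by rewrite coprod_basis /tmap linear_sum; apply: eq_bigr => I _ /=; rewrite lextU.
Qed.

Lemma pair2_sum a b (I : Type) (r : seq I) (P : pred I) (F : I -> HDP2 K) :
  pair2 a b (\sum_(i <- r | P i) F i) = \sum_(i <- r | P i) pair2 a b (F i).
Proof. by rewrite /pair2 linear_sum. Qed.

Lemma tmul_sum (I J : finType) (P : pred I) (Q : pred J) (F : I -> HDP2 K) (G : J -> HDP2 K) :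
  tmul (\sum_(i | P i) F i) (\sum_(j | Q j) G j) =
  \sum_(i | P i) \sum_(j | Q j) tmul (F i) (G j).
Proof.
rewrite /tmul linear_sum; apply: eq_bigr => i _ /=.
rewrite -/(tmul _ _); elim/big_rec2: _ => [|j y1 y2 _ <-].
  by have := tmul_linr (F i) (-1) 0 0; rewrite scaler0 addr0 scaleN1r addrC subrr.
by have := tmul_linr (F i) 1 (G j) y2; rewrite !scale1r.
Qed.

Lemma pairing_mul_tmap f a b x y :
  coprod (f x) = tmap f (coprod << x >>) -> coprod (f y) = tmap f (coprod << y >>) ->
  pairing (a * b) (f x * f y) =
  \sum_(I : {set 'I_(crd x)} | upset (rep x) I) \sum_(J : {set 'I_(crd y)} | upset (rep y) J)
    pairing a (f (csub (rep x) (~: I)) * f (csub (rep y) (~: J))) *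
    pairing b (f (csub (rep x) I) * f (csub (rep y) J)).
Proof.
move=> cx cy; rewrite pairing_mul coprodM cx cy !tmap_coprod tmul_sum pair2_sum.
apply: eq_bigr => I _; rewrite pair2_sum; apply: eq_bigr => J _.
by rewrite tmul_tens pair2_tens.
Qed.

Lemma npic_mul_mul x y x' y' : (npic (cmul x y) (cmul x' y'))%:R =
  \sum_(I : {set 'I_(crd x')} | upset (rep x') I) \sum_(J : {set 'I_(crd y')} | upset (rep y') J)
    (npic x (cmul (csub (rep x') (~: I)) (csub (rep y') (~: J))))%:R *
    (npic y (cmul (csub (rep x') I) (csub (rep y') J)))%:R :> K.
Proof.
pose U (x : isoclass) : HDP K := << x >>.
have cU z : coprod (U z) = tmap U (coprod << z >>).
  by rewrite tmap_coprod coprod_basis; apply: eq_bigr => I _; rewrite tens_basis.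
rewrite -pairing_basis -!mul_basis (pairing_mul_tmap _ _ (cU x') (cU y')).
by apply: eq_bigr => I _; apply: eq_bigr => J _; rewrite !mul_basis !pairing_basis.
Qed.

Lemma crd_csub_le x (I : {set 'I_(crd x)}) : (crd (csub (rep x) I) <= crd x)%N.
Proof. by rewrite crd_csub -[X in (_ <= X)%N]card_ord max_card. Qed.

(** The Hopf pairing and the multiplicativity of the coproduct expand both sides into
    pairings of an element with a product of two, all of degree less than [N], where
    [f] is known to be multiplicative and isometric. *)
Lemma isometry_below_mul N f x y x' y' : isometry_below N f ->
  planec x -> planec y -> planec x' -> planec y' ->
  (crd x < N)%N -> (crd y < N)%N -> (crd x' < N)%N -> (crd y' < N)%N ->
  pairing (f x * f y) (f x' * f y') = (npic (cmul x y) (cmul x' y'))%:R.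
Proof.
move=> gf px py px' py' lx ly lx' ly'.
have key z k l : planec z -> planec k -> planec l -> (crd z < N)%N -> (crd k < N)%N ->
    (crd l < N)%N -> pairing (f z) (f k * f l) = (npic z (cmul k l))%:R.
  move=> pz pk pl lz lk ll; have [e|ne] := eqVneq (crd z) (crd k + crd l)%N.
    rewrite -(goodM gf) // -?e // (goodP gf) //; first exact: planecM.
    by rewrite crd_mul -e.
  rewrite (pairing_crd0 (goodS gf pz lz) (inSM (goodS gf pk lk) (goodS gf pl ll)) ne).
  by rewrite npic_crd // crd_mul.
rewrite (pairing_mul_tmap _ _ (goodC gf px' lx') (goodC gf py' ly')) npic_mul_mul.
apply: eq_bigr => I _; apply: eq_bigr => J _.
by rewrite !key //; do ?[exact: planec_csub]; exact: leq_ltn_trans (crd_csub_le _) _.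
Qed.

(** * Decomposable classes *)

Definition splitb x (A : {set 'I_(crd x)}) : bool :=
  [&& A != set0, A != setT & cut (rep x) A (~: A)].
Definition decomposable x : bool := [exists A : {set 'I_(crd x)}, splitb A].

(** The value forced by multiplicativity on a decomposable class. *)
Definition forced f x : HDP K :=
  if [pick A : {set 'I_(crd x)} | splitb A] is Some A
  then f (csub (rep x) A) * f (csub (rep x) (~: A)) else 0.

Lemma splitbP x (A : {set 'I_(crd x)}) : splitb A ->
  [/\ x = cmul (csub (rep x) A) (csub (rep x) (~: A)),
      (0 < crd (csub (rep x) A))%N & (0 < crd (csub (rep x) (~: A)))%N].
Proof.
case/and3P=> A0 AT cA; split.
- by rewrite -csub_cut // setUCr csubT repK.
- by rewrite crd_csub card_gt0.
- rewrite crd_csub card_gt0; apply: contra AT => /eqP e.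
  by rewrite -[A]setCK e setC0.
Qed.

Lemma decomposableP x : reflect (exists y z, [/\ x = cmul y z, (0 < crd y)%N & (0 < crd z)%N])
  (decomposable x).
Proof.
apply: (iffP existsP) => [[A /splitbP[e h1 h2]]|[y [z [e h1 h2]]]].
  by exists (csub (rep x) A), (csub (rep x) (~: A)).
have [A [cA yA zA]] := cut_of_mul e.
exists A; rewrite /splitb cA andbT.
move: h1 h2; rewrite yA zA !crd_csub !card_gt0 => -> /=.
by apply: contra => /eqP->; rewrite setCT.
Qed.

(** Levi's lemma makes the forced value independent of the factorization: compare two
    factorizations through their common refinement. *)
Lemma forced_mul N f x y : isometry_below N f -> planec (cmul x y) ->
  (0 < crd x)%N -> (0 < crd y)%N -> (crd x + crd y <= N)%N ->
  forced f (cmul x y) = f x * f y.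
Proof.
move=> gf pxy x0 y0 lN; rewrite /forced.
case: pickP => [A /splitbP[]|none]; last first.
  have /decomposableP/existsP[A] : exists y' z, [/\ cmul x y = cmul y' z, (0 < crd y')%N & (0 < crd z)%N].
    by exists x, y.
  by rewrite none.
move: (csub _ A) (csub _ (~: A)) => u v e u0 v0.
have [px py] := planecM_inv pxy; have [pu pv] : planec u /\ planec v.
  by apply: planecM_inv; rewrite -e.
have ed : (crd u + crd v = crd x + crd y)%N by rewrite -!crd_mul e.
have [ux|/ltnW xu] := leqP (crd u) (crd x).
  have [t [ex ev]] := cmul_levi e ux.
  have [_ pt] : planec u /\ planec t by apply: planecM_inv; rewrite -ex.
  have := congr1 crd ex; have := congr1 crd ev; rewrite !crd_mul => cv cx.
  by rewrite ev ex !(goodM gf) // ?mulrA //; lia.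
have [t [eu ey]] := cmul_levi (esym e) xu.
have [_ pt] : planec x /\ planec t by apply: planecM_inv; rewrite -eu.
have := congr1 crd eu; have := congr1 crd ey; rewrite !crd_mul => cy cu.
by rewrite eu ey !(goodM gf) // ?mulrA //; lia.
Qed.

End IsometryBelow.

(** * Extension to the next degree *)

Lemma bform_row (K : fieldType) m k l (B : 'M[K]_m) (A : 'M_(k, m)) (A' : 'M_(l, m)) a b :
  (A *m B *m A'^T) a b = bform B (row a A) (row b A').
Proof.
rewrite /bform -row_mul !mxE; apply: eq_bigr => j _.
by rewrite [in RHS]mxE [(row b A')^T _ _]mxE [(row b A') _ _]mxE [A'^T _ _]mxE.
Qed.

Lemma linear_sumZ (K : fieldType) (V W : lmodType K) (L : V -> W) : linear L ->
  forall (I : finType) (c : I -> K) (F : I -> V),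
  L (\sum_i c i *: F i) = \sum_i c i *: L (F i).
Proof.
move=> lL I c F; pose L' : {linear V -> W} := HB.pack L (GRing.isLinear.Build _ _ _ _ L lL).
rewrite -[L]/(L' : V -> W) linear_sum; apply: eq_bigr => i _.
by rewrite linearZ.
Qed.

Section Step.
Variables (K : fieldType) (N : nat) (f : isoclass -> HDP K).
Hypotheses (N0 : (0 < N)%N) (gf : isometry_below N f).
Implicit Types (r s : 'S_N) (x y z : isoclass).

Definition decperm : {pred 'S_N} := fun r => decomposable (pcl r).

Lemma decperm_factor r : decperm r -> exists k l (r1 : 'S_k) (r2 : 'S_l),
  [/\ (0 < k < N)%N, (0 < l < N)%N, (k + l)%N = N & pcl r = cmul (pcl r1) (pcl r2)].
Proof.
case/decomposableP=> y [z [e y0 z0]].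
have [py pz] : planec y /\ planec z by apply: planecM_inv; rewrite -e; apply: planec_pcl.
have [r1 e1] := planec_perm py erefl; have [r2 e2] := planec_perm pz erefl.
have eN : (crd y + crd z)%N = N by rewrite -crd_mul -e crd_pcl.
exists (crd y), (crd z), r1, r2; split; rewrite ?y0 ?z0 //=; try by lia.
by rewrite -e1 -e2.
Qed.

Lemma forced_factor r k l (r1 : 'S_k) (r2 : 'S_l) :
  (0 < k)%N -> (0 < l)%N -> pcl r = cmul (pcl r1) (pcl r2) ->
  forced f (pcl r) = f (pcl r1) * f (pcl r2).
Proof.
move=> k0 l0 e; rewrite e; apply: (forced_mul gf); rewrite -?e ?crd_pcl //.
  exact: planec_pcl.
by have := congr1 crd e; rewrite crd_mul !crd_pcl => <-.
Qed.

Lemma forced_inS r : decperm r -> inS N (forced f (pcl r)).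
Proof.
case/decperm_factor=> k [l [r1 [r2 [/andP[k0 kN] /andP[l0 lN] eN e]]]].
rewrite (forced_factor k0 l0 e) -eN; apply: inSM.
  by rewrite -{1}(crd_pcl r1); apply: (goodS gf (planec_pcl _)); rewrite crd_pcl.
by rewrite -{1}(crd_pcl r2); apply: (goodS gf (planec_pcl _)); rewrite crd_pcl.
Qed.

Lemma forced_pairing r s : decperm r -> decperm s ->
  pairing (forced f (pcl r)) (forced f (pcl s)) = (npictures (pposet r) (pposet s))%:R.
Proof.
move=> /decperm_factor[k [l [r1 [r2 [/andP[k0 kN] /andP[l0 lN] _ e]]]]].
move=> /decperm_factor[k' [l' [s1 [s2 [/andP[k0' kN'] /andP[l0' lN'] _ e']]]]].
rewrite (forced_factor k0 l0 e) (forced_factor k0' l0' e').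
rewrite (isometry_below_mul gf) ?crd_pcl //; try exact: planec_pcl.
by rewrite -e -e' npic_cls.
Qed.

Definition forced_mx : 'M[K]_(#|decperm|, #|'S_N|) :=
  \matrix_(a < #|decperm|) vecS N (forced f (pcl (enum_val a))).

Lemma forced_mx_gram :
  forced_mx *m gramS K N *m forced_mx^T = selmx K decperm *m gramP K N *m (selmx K decperm)^T.
Proof.
apply/matrixP=> a b; rewrite bform_row !rowK selmx_congr mxE !enum_rankK.
have Da : decperm (enum_val a) by exact: (enum_valP a).
have Db : decperm (enum_val b) by exact: (enum_valP b).
rewrite -pairing_ofS !vecSK ?forced_pairing //; exact: forced_inS.
Qed.

(** The factors of a decomposable special plane poset are combinations of values of
    [f], so the forced values span the decomposable special plane posets. The latter
    are as many as the decomposable plane posets, hence the forced values are linearly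
    independent. *)
Lemma forced_mx_free : row_free forced_mx.
Proof.
suff sub : (selmx K decperm <= forced_mx)%MS.
  by rewrite /row_free eqn_leq rank_leq_row -{1}(eqP (selmx_free K decperm)) mxrankS.
apply/row_subP=> a; have Da : decperm (enum_val a) by exact: (enum_valP a).
have -> : row a (selmx K decperm) = vecS N << scl (enum_val a) >>.
  rewrite -ofS_delta ofSK; apply/rowP=> j; rewrite !mxE eqxx /=.
  by rewrite -[enum_val j == _](inj_eq enum_rank_inj) enum_valK.
move: (enum_val a) Da => r /decperm_factor[k [l [r1 [r2 [/andP[k0 kN] /andP[l0 lN] eN e]]]]].
have es : scl r = cmul (scl r1) (scl r2) := sposet_cmul e.
have [c hc] := goodO gf r1 kN; have [d hd] := goodO gf r2 lN.
rewrite es -mul_basis hc hd mulr_suml linear_sum /=; apply: summx_sub => s1 _.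
rewrite mulr_sumr linear_sum /=; apply: summx_sub => s2 _.
rewrite -scalerAl malg_scaleAr !linearZ /=; do 2!apply: scalemx_sub.
have [t et] : exists t : 'S_N, cmul (pcl s1) (pcl s2) = pcl t.
  by apply: planec_perm; [apply: planecM; apply: planec_pcl | rewrite crd_mul !crd_pcl].
have Dt : t \in decperm.
  by apply/decomposableP; exists (pcl s1), (pcl s2); rewrite et !crd_pcl.
rewrite -(forced_factor k0 l0 (esym et)).
have <- : row (enum_rank_in Dt t) forced_mx = vecS N (forced f (pcl t)).
  by rewrite rowK enum_rankK_in.
exact: row_sub.
Qed.

(** The forced rows have the required Gram matrix. An isometry [S] of the whole degree,
    given by [gram_congruent], is corrected on the decomposable part by Witt's theorem. *)
Lemma extension_mx (i : K) : (2 : K) != 0 -> i ^+ 2 = -1 ->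
  exists G : 'M[K]_#|'S_N|, G *m gramS K N *m G^T = gramP K N /\
    forall r, decperm r -> ofS (row (enum_rank r) G) = forced f (pcl r).
Proof.
move=> K2 i2; have [S hS] := gram_congruent N K2 i2.
have Su : S \in unitmx.
  by have := gramP_unit K N; rewrite -hS !unitmx_mul => /andP[/andP[]].
have A1f : row_free (selmx K decperm *m S).
  by rewrite /row_free mxrankMfree ?row_free_unit //; apply: selmx_free.
have [|H [hH AH]] := witt_extension K2 (gramS_sym K N) (gramS_unit K N) A1f forced_mx_free.
  by rewrite forced_mx_gram -hS trmx_mul !mulmxA.
exists (S *m H); split.
  by rewrite trmx_mul !mulmxA -(mulmxA S H) -(mulmxA S (H *m _)) hH.
move=> r Dr; have Dr' : r \in decperm by [].
have <- : row (enum_rank_in Dr' r) forced_mx = row (enum_rank r) (S *m H).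
  rewrite -AH -mulmxA; apply/rowP=> j.
  by rewrite [LHS]mxE mul_selmx enum_rankK_in // [RHS]mxE.
by rewrite rowK enum_rankK_in // vecSK //; apply: forced_inS.
Qed.

Variable G : 'M[K]_#|'S_N|.
Hypothesis GG : G *m gramS K N *m G^T = gramP K N.
Hypothesis GD : forall r, decperm r -> ofS (row (enum_rank r) G) = forced f (pcl r).

Definition extend x : HDP K :=
  if crd x == N then
    if [pick r : 'S_N | x == pcl r] is Some r then ofS (row (enum_rank r) G) else 0
  else f x.

Lemma extend_lt x : (crd x < N)%N -> extend x = f x.
Proof. by rewrite /extend ltn_neqAle => /andP[/negPf->]. Qed.

Lemma extend_pcl r : extend (pcl r) = ofS (row (enum_rank r) G).
Proof.
rewrite /extend crd_pcl eqxx; case: pickP => [s /eqP/pcl_inj-> //|/(_ r)].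
by rewrite eqxx.
Qed.

Lemma extendM x y : planec x -> planec y -> (crd x + crd y <= N)%N ->
  extend (cmul x y) = extend x * extend y.
Proof.
move=> px py le.
have [/crd_eq0 x0|x0] := posnP (crd x).
  have e1 : extend cone = 1.
    by rewrite extend_lt ?(good1 gf) // crd_cone.
  by rewrite x0 cmul1x e1 mul1r.
have [/crd_eq0 y0|y0] := posnP (crd y).
  have e1 : extend cone = 1.
    by rewrite extend_lt ?(good1 gf) // crd_cone.
  by rewrite y0 cmulx1 e1 mulr1.
rewrite [extend x]extend_lt ?[extend y]extend_lt; try by lia.
move: le; rewrite leq_eqVlt => /orP[/eqP e|lt]; last first.
  by rewrite extend_lt ?crd_mul // (goodM gf).
have pxy := planecM px py.
have [r er] : exists r : 'S_N, cmul x y = pcl r by apply: planec_perm; rewrite ?crd_mul.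
rewrite -(forced_mul gf pxy x0 y0) ?e // er extend_pcl GD //.
by apply/decomposableP; exists x, y; rewrite er.
Qed.

Lemma extendS x : planec x -> (crd x <= N)%N -> inS (crd x) (extend x).
Proof.
move=> px; rewrite leq_eqVlt => /orP[/eqP e|lt]; last by rewrite extend_lt //; apply: (goodS gf).
by have [r ->] := planec_perm px e; rewrite extend_pcl crd_pcl; apply: inS_ofS.
Qed.

Lemma extendP x y : planec x -> planec y -> (crd x <= N)%N -> (crd y <= N)%N ->
  pairing (extend x) (extend y) = (npic x y)%:R.
Proof.
move=> px py lx ly; have [e|ne] := eqVneq (crd x) (crd y); last first.
  by rewrite (pairing_crd0 (extendS px lx) (extendS py ly) ne) npic_crd.
move: lx; rewrite leq_eqVlt => /orP[/eqP ex|lt]; last first.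
  by rewrite !extend_lt -?e // (goodP gf) // -e.
have [r ->] := planec_perm px ex; have [|s ->] := planec_perm py (n := N); first by rewrite -e.
by rewrite !extend_pcl pairing_ofS -bform_row GG mxE !enum_rankK npic_cls.
Qed.

Lemma extendO n (s : 'S_n) : (n <= N)%N ->
  exists c : 'S_n -> K, << scl s >> = \sum_(r : 'S_n) c r *: extend (pcl r).
Proof.
rewrite leq_eqVlt => /orP[/eqP e|lt]; last first.
  have [c ->] := goodO gf s lt; exists c; apply: eq_bigr => r _.
  by rewrite extend_lt // crd_pcl.
subst n; have Gu : G \in unitmx.
  by have := gramP_unit K N; rewrite -GG !unitmx_mul => /andP[/andP[]].
exists (fun r => invmx G (enum_rank s) (enum_rank r)).
rewrite -ofS_delta -[delta_mx _ _](mulmxKV Gu) -rowE.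
have -> : row (enum_rank s) (invmx G) *m G =
    \sum_j invmx G (enum_rank s) j *: row j G.
  rewrite mulmx_sum_row; apply: eq_bigr => j _; by rewrite mxE.
rewrite linear_sum /= (reindex _ (onW_bij _ (enum_rank_bij 'S_N))) /=.
by apply: eq_bigr => r _; rewrite linearZ /= extend_pcl.
Qed.

Lemma coprod_inS x : planec x -> (crd x <= N)%N -> forall k, (coprod (extend x))@_k != 0 ->
  [/\ specialc k.1, specialc k.2 & (crd k.1 + crd k.2)%N = crd x].
Proof.
move=> px lx k; have hx := extendS px lx.
rewrite (linear_lext (@coprod_lin K)) /lext raddf_sum /= => nz.
have [q qx] : exists2 q, q \in msupp (extend x) & (coprod << q >>)@_k != 0 :> K.
  apply/hasP; apply: contraNT nz => /hasPn h; rewrite big_seq big1 // => q /h.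
  by rewrite negbK mcoeffZ => /eqP->; rewrite mulr0.
rewrite -mcoeff_neq0 in qx; have [sq <-] := hx _ qx.
rewrite coprod_basis raddf_sum /= => nz'.
have [I] : exists I : {set 'I_(crd q)}, (csub (rep q) (~: I), csub (rep q) I) == k.
  apply/existsP; apply: contraNT nz' => /existsPn h; rewrite big1 // => I _.
  by rewrite mcoeffU (negPf (h I)).
move=> /eqP <- /=; split; try exact: specialc_csub.
by rewrite !crd_csub addnC cardsC card_ord.
Qed.

Lemma tens_inS k l a b : inS k a -> inS l b -> forall p, (tens a b : HDP2 K)@_p != 0 ->
  [/\ specialc p.1, specialc p.2 & (crd p.1 + crd p.2)%N = (k + l)%N].
Proof.
move=> ha hb p nz.
suff /and3P[s1 s2 /eqP e] : [&& specialc p.1, specialc p.2 & (crd p.1 + crd p.2 == k + l)%N] by [].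
apply: contraNT nz => np; apply/eqP.
rewrite /tens raddf_sum /= big_seq big1 // => x; rewrite -mcoeff_neq0 => /ha[sx cx].
rewrite raddf_sum /= big_seq big1 // => y; rewrite -mcoeff_neq0 => /hb[sy cy].
by rewrite mcoeffU; case: eqP => // e; case/negP: np; rewrite -e /= cx cy eqxx andbT; apply/andP.
Qed.

(** Multiplicativity and isometry force compatibility with the coproduct: both sides
    have the same pairing with every tensor of values of [extend], by the Hopf pairing. *)
Lemma extendC x : planec x -> (crd x <= N)%N ->
  coprod (extend x) = tmap extend (coprod << x >>).
Proof.
move=> px lx.
have pc (I : {set 'I_(crd x)}) : planec (csub (rep x) I) := planec_csub I px.
have lc (I : {set 'I_(crd x)}) : (crd (csub (rep x) I) <= N)%N := leq_trans (crd_csub_le I) lx.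
apply/eqP; rewrite -subr_eq0; apply/eqP; apply: (@nondegenerate2 _ (crd x)) => [k|p q sp sq e].
  rewrite mcoeffB; have [->|/coprod_inS h _] := eqVneq ((coprod (extend x))@_k) 0; last exact: h.
  rewrite sub0r oppr_eq0 tmap_coprod raddf_sum /= => nz.
  have [I] : exists I : {set 'I_(crd x)},
      (tens (extend (csub (rep x) (~: I))) (extend (csub (rep x) I)))@_k != 0.
    apply/existsP; apply: contraNT nz => /existsPn h; rewrite big1 // => I _.
    by apply/eqP; have := h I; rewrite negbK.
  case/(tens_inS (extendS (pc _) (lc _)) (extendS (pc _) (lc _))) => ? ? ->.
  by split=> //; rewrite !crd_csub addnC cardsC card_ord.
have [r er] := specialc_perm sp erefl; have [s es] := specialc_perm sq erefl.
have [|c hc] := extendO r; first by rewrite (leq_trans _ lx) // -e leq_addr.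
have [|d hd] := extendO s; first by rewrite (leq_trans _ lx) // -e leq_addl.
rewrite er es hc hd.
have key u v : planec u -> planec v -> (crd u + crd v)%N = crd x ->
    pair2 (extend u) (extend v) (coprod (extend x) - tmap extend (coprod << x >>)) = 0.
  move=> pu pv euv; rewrite /pair2 linearB /= -!/(pair2 _ _ _).
  rewrite -pairing_mul -extendM ?euv // (extendP (planecM pu pv)) ?crd_mul ?euv //.
  rewrite tmap_coprod pair2_sum npic_mul; apply/eqP; rewrite subr_eq0; apply/eqP.
  apply: eq_bigr => I _; rewrite pair2_tens !extendP //; lia.
rewrite (linear_sumZ (pair2_linl _ _)) big1 // => u _.
rewrite (linear_sumZ (pair2_linr _ _)) big1 ?scaler0 // => v _.
by rewrite key ?scaler0 // ?crd_pcl //; apply: planec_pcl.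
Qed.

End Step.

(** * The isometry in all degrees *)

Section Construct.
Variables (K : fieldType).
Implicit Types (x y z : isoclass) (f g : isoclass -> HDP K).

Lemma isometry_step N f (i : K) :
  (0 < N)%N -> (2 : K) != 0 -> i ^+ 2 = -1 -> isometry_below N f ->
  exists g, isometry_below N.+1 g /\ forall x, (crd x < N)%N -> g x = f x.
Proof.
move=> N0 K2 i2 gf; have [G [GG GD]] := extension_mx N0 gf K2 i2.
exists (extend f G); split; last by move=> x; apply: extend_lt.
split.
- by rewrite extend_lt ?(good1 gf) // crd_cone.
- by move=> x y px py lt; apply: extendM.
- by move=> x px lt; apply: extendS.
- by move=> x y px py lx ly; apply: extendP.
- by move=> x px lt; apply: extendC.
- by move=> n s lt; apply: extendO.
Qed.

Lemma isometry_below1 : isometry_below 1 (fun=> 1 : HDP K).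
Proof.
have one : 1 = << cone >> :> HDP K by [].
split=> //.
- by move=> x y _ _ _; rewrite mulr1.
- move=> x _; rewrite ltnS leqn0 => /eqP/crd_eq0->; rewrite one; apply: inSU.
  exact: special_rep1.
- move=> x y _ _; rewrite !ltnS !leqn0 => /eqP/crd_eq0-> /eqP/crd_eq0->.
  by rewrite one pairing_basis.
- move=> x _; rewrite ltnS leqn0 => /eqP/crd_eq0->; rewrite tmap_coprod {1}one coprod_basis.
  apply: eq_bigr => I _; rewrite one tens_basis.
  by congr << (_, _) >>; apply: crd_eq0; apply/eqP; rewrite -leqn0 -crd_cone crd_csub_le.
- move=> n s; rewrite ltnS leqn0 => /eqP n0; subst n; exists (fun=> 1).
  rewrite sumr_const card_Sn fact0 mulr1n scale1r one; congr << _ >>.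
  by apply: crd_eq0; rewrite crd_scl.
Qed.

Lemma eq_isometry_below N f g : 
  (0 < N)%N -> (forall x, (crd x < N)%N -> f x = g x) ->
  isometry_below N f -> isometry_below N g.
Proof.
move=> N0 e gf; split.
- by rewrite -e ?(good1 gf) ?crd_cone.
- by move=> x y px py lt; rewrite -!e ?(goodM gf) ?crd_mul //; lia.
- by move=> x px lt; rewrite -e //; apply: (goodS gf).
- by move=> x y px py lx ly; rewrite -!e //; apply: (goodP gf).
- move=> x px lx; rewrite -e // (goodC gf) // !tmap_coprod; apply: eq_bigr => I _.
  by rewrite !e // (leq_ltn_trans (crd_csub_le _)).
- move=> n s lt; have [c ->] := goodO gf s lt; exists c; apply: eq_bigr => r _.
  by rewrite e // crd_pcl.
Qed.

(** Each extension agrees with the previous map in the degrees already treated, so the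
    value of the limit at [x] is the one fixed at stage [crd x]. *)
Lemma isometry_exists (i : K) : (2 : K) != 0 -> i ^+ 2 = -1 ->
  exists f : isoclass -> HDP K, forall N, isometry_below N.+1 f.
Proof.
move=> K2 i2.
have step N (f : {f : isoclass -> HDP K | isometry_below N.+1 f}) :
    {g : {g : isoclass -> HDP K | isometry_below N.+2 g} |
      forall x, (crd x < N.+1)%N -> sval g x = sval f x}.
  apply: constructive_indefinite_description; case: f => f gf /=.
  have [g [gg e]] := isometry_step (ltn0Sn N) K2 i2 gf.
  by exists (exist _ g gg).
pose F : forall N, {f : isoclass -> HDP K | isometry_below N.+1 f} :=
  nat_rect (fun N => {f : isoclass -> HDP K | isometry_below N.+1 f})
    (exist _ _ isometry_below1) (fun N h => sval (step N h)).
have FS N x : (crd x < N.+1)%N -> sval (F N.+1) x = sval (F N) x.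
  exact: (svalP (step N (F N))).
have Fle N x : (crd x <= N)%N -> sval (F N) x = sval (F (crd x)) x.
  elim: N => [|N IH]; first by rewrite leqn0 => /eqP->.
  rewrite leq_eqVlt => /orP[/eqP->//|lt].
  by rewrite FS // IH.
exists (fun x => sval (F (crd x)) x) => N.
apply: (eq_isometry_below _ _ (svalP (F N))) => // x; rewrite ltnS; exact: Fle.
Qed.

End Construct.

(** * The isomorphism *)

Section Isomorphism.
Variables (K : fieldType) (f : isoclass -> HDP K).
Hypothesis gf : forall N, isometry_below N.+1 f.
Implicit Types (x y z : isoclass) (a b : HPP K).

Let fM x y (px : planec x) (py : planec y) : f (cmul x y) = f x * f y.
Proof. exact: (goodM (gf _)). Qed.
Let fS x (px : planec x) : inS (crd x) (f x).
Proof. exact: (goodS (gf _)). Qed.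
Let fP x y (px : planec x) (py : planec y) : pairing (f x) (f y) = (npic x y)%:R.
Proof. by apply: (goodP (gf (maxn (crd x) (crd y)))) => //; rewrite ltnS ?leq_maxl ?leq_maxr. Qed.
Let fC x (px : planec x) : coprod (f x) = tmap f (coprod << x >>).
Proof. exact: (goodC (gf _)). Qed.

Lemma hvalP a p : (hval a)@_p != 0 -> planec p.
Proof. by case: a => a /= /hspanP; apply. Qed.

Lemma lext_coeff (c : HDP K) q : (lext f c)@_q != 0 ->
  exists p, c@_p != 0 /\ (f p)@_q != 0.
Proof.
rewrite /lext raddf_sum /= => nz.
have [p pc h] : exists2 p, p \in msupp c & (f p)@_q != 0.
  apply/hasP; apply: contraNT nz => /hasPn h; rewrite big_seq big1 // => p /h.
  by rewrite negbK mcoeffZ => /eqP->; rewrite mulr0.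
by exists p; rewrite mcoeff_neq0.
Qed.

Lemma lext_special a : lext f (hval a) \in hspan special_plane_family.
Proof. by apply/hspanP=> q /lext_coeff[p [/hvalP pp /(fS pp)[]]]. Qed.

Definition iso a : HSPP K := HSub (lext_special a).

Lemma iso_linear : linear iso.
Proof. by move=> c a b; apply: val_inj; rewrite /= linearP. Qed.

Lemma iso_monoid : monoid_morphism iso.
Proof.
split; first by apply: val_inj; rewrite /= lextU (good1 (gf 0)).
move=> a b; apply: val_inj => /=.
have l1 := comp_lin (lext_is_linear f) (mul_linl (hval b)).
apply: (linear_eq l1 (comp_lin (mul_linl _) (lext_is_linear f))) => x /hvalP px.
have l2 := comp_lin (lext_is_linear f) (mul_linr << x >>).
apply: (linear_eq l2 (comp_lin (mul_linr _) (lext_is_linear f))) => y /hvalP py.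
by rewrite mul_basis !lextU fM.
Qed.

Lemma iso_isometric : isometric iso.
Proof.
move=> a b /=.
have l1 := comp_lin (pairing_linl (lext f (hval b))) (lext_is_linear f).
apply: (linear_eq l1 (pairing_linl _)) => x /hvalP px.
have l2 := comp_lin (pairing_linr (lext f << x >>)) (lext_is_linear f).
apply: (linear_eq l2 (pairing_linr _)) => y /hvalP py.
by rewrite !lextU fP // pairing_basis.
Qed.

Lemma hbase_iso x : planec x -> hval (iso (hbase K plane_family x)) = f x.
Proof. by move=> px; rewrite /= hbaseE // lextU. Qed.

Lemma iso_coalg : coalg_morph iso.
Proof.
move=> a; split=> /=.
  have l1 := comp_lin (@coprod_lin K) (lext_is_linear f).
  pose F k := tens (hval (iso (hbase K plane_family k.1))) (hval (iso (hbase K plane_family k.2))).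
  have l2 := comp_lin (lext_is_linear F) (@coprod_lin K).
  apply: (linear_eq l1 l2) => x /hvalP px.
  rewrite lextU fC // tmap_coprod coprod_basis linear_sum; apply: eq_bigr => I _ /=.
  rewrite lextU /F !hbase_iso //; exact: planec_csub.
have l1 : linear (fun c : HDP K => counit c : K^o).
  by move=> s c d; rewrite /counit mcoeffD mcoeffZ.
apply: (linear_eq (comp_lin l1 (lext_is_linear f)) l1) => x /hvalP px.
rewrite lextU /counit mcoeffU; case: (x =P cone) => [->|ne].
  by rewrite (good1 (gf 0)) mcoeff1 eqxx.
apply/eqP; rewrite mulr0n; apply/negPn/negP=> /(fS px)[_ cx].
by apply: ne; apply: crd_eq0; rewrite -cx crd_cone.
Qed.

Lemma iso_homogeneous : homogeneous iso.
Proof.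
move=> n a /allP ha; apply/allP=> q; rewrite -mcoeff_neq0 /= => /lext_coeff[p [ap fq]].
have [_ ->] := fS (hvalP ap) fq; apply: ha; by rewrite -mcoeff_neq0.
Qed.

(** The inverse of the Gram matrix gives the dual basis of plane posets. *)
Lemma dualP x : planec x -> exists b, forall a, pairing (hval a) (hval b) = (hval a)@_x.
Proof.
move=> px; have [r er] := planec_perm px erefl; pose n := crd x.
pose w := delta_mx (0 : 'I_1) (enum_rank r) *m invmx (gramP K n).
pose c : HDP K := \sum_j w 0 j *: << pcl (enum_val j) >>.
have cP : c \in hspan plane_family.
  by apply: rpred_sum => j _; apply: rpredZ; apply/hspanP=> q; rewrite mcoeffU;
     case: (_ =P q) => [<- _|_]; [apply: planec_pcl | rewrite eqxx].
exists (HSub cP) => a /=.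
have l : linear (fun c : HDP K => c@_x : K^o) by move=> s d e; rewrite mcoeffD mcoeffZ.
apply: (linear_eq (pairing_linl c) l) => q /hvalP pq; rewrite pairing_sumr mcoeffU.
have [e|ne] := eqVneq (crd q) n; last first.
  rewrite big1 => [|j _]; last by rewrite pairingZr pairing_basis npic_crd ?mulr0 // crd_pcl.
  by case: (q =P x) ne => // ->; rewrite eqxx.
have [s ->] := planec_perm pq e.
transitivity ((w *m gramP K n) 0 (enum_rank s)).
  rewrite mxE; apply: eq_bigr => j _.
  by rewrite pairingZr pairing_basis npic_cls npictures_sym [gramP _ _ _ _]mxE enum_rankK.
by rewrite mulmxKV ?gramP_unit // mxE eqxx (inj_eq enum_rank_inj) -(inj_eq (@pcl_inj n)) -er.
Qed.

Lemma iso_inj : injective iso.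
Proof.
move=> a b e; apply: val_inj => /=; apply/malgP=> p.
have [pp|np] := boolP (planec p).
  by have [c hc] := dualP pp; rewrite -!hc -!iso_isometric e.
have h (d : HPP K) : (hval d)@_p = 0.
  by apply/eqP; apply: contraNT np; apply: hvalP.
by rewrite !h.
Qed.

Lemma iso_surj (b : HSPP K) : exists a, iso a = b.
Proof.
suff [c cP e] : exists2 c, c \in hspan plane_family & lext f c = hval b.
  by exists (HSub cP); apply: val_inj.
have sb p : (hval b)@_p != 0 -> specialc p by case: b => b /= /hspanP; apply.
rewrite (malg_sum (hval b)) big_seq; 
apply: (big_ind (fun d => exists2 c, c \in hspan plane_family & lext f c = d))
  => [|c d [c' c'P <-] [d' d'P <-]|q].
- by exists 0; [apply: rpred0 | rewrite linear0].
- by exists (c' + d'); [apply: rpredD | rewrite linearD].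
rewrite -mcoeff_neq0 => /sb sq; have [s es] := specialc_perm sq erefl.
have [w hw] := goodO (gf (crd q)) s (ltnSn _).
exists ((hval b)@_q *: \sum_r w r *: << pcl r >>); last first.
  rewrite linearZ /= (linear_sumZ (lext_is_linear f)); congr (_ *: _).
  by rewrite [in RHS]es hw; apply: eq_bigr => r _; rewrite lextU.
apply: rpredZ; apply: rpred_sum => r _; apply: rpredZ; apply/hspanP=> p.
by rewrite mcoeffU; case: (_ =P p) => [<- _|_]; [apply: planec_pcl | rewrite eqxx].
Qed.

Lemma iso_bij : bijective iso.
Proof.
have s (b : HSPP K) : exists a, iso a == b by have [a <-] := iso_surj b; exists a.
exists (fun b : HSPP K => xchoose (s b)) => [a|b]; last exact/eqP/(xchooseP (s b)).
by apply: iso_inj; apply/eqP/(xchooseP (s _)).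
Qed.

End Isomorphism.

(** * Degree two *)

Lemma perm2P (r : 'S_2) : r = 1%g \/ r = tperm ord0 ord_max.
Proof.
have h (i : 'I_2) : i = ord0 \/ i = ord_max.
  by case: i => [[|[|//]]] hi; [left | right]; apply: val_inj.
have n01 : ord0 != ord_max :> 'I_2 by [].
have inj := @perm_inj _ r.
case: (h (r ord0)) => e0; case: (h (r ord_max)) => e1.
- by move/eqP: n01; case; apply: inj; rewrite e0 e1.
- by left; apply/permP=> i; rewrite perm1; case: (h i) => ->.
- by right; apply/permP=> i; case: (h i) => ->; rewrite ?tpermL ?tpermR.
- by move/eqP: n01; case; apply: inj; rewrite e0 e1.
Qed.

Notation swap2 := (tperm ord0 ord_max : 'S_2).

Lemma sum_perm2 (V : nmodType) (F : 'S_2 -> V) : \sum_r F r = F 1%g + F swap2.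
Proof.
have ne : swap2 != 1%g by apply/eqP=> /permP/(_ ord0); rewrite tpermL perm1.
rewrite (bigD1 1%g) //= (bigD1 swap2) //= big1 ?addr0 // => r.
by case: (perm2P r) => ->; rewrite eqxx ?andbF.
Qed.

Lemma rev_perm2 : rev_perm 1 = swap2.
Proof.
case: (perm2P (rev_perm 1)) => // /permP/(_ ord0)/(congr1 (@nat_of_ord 2)).
by rewrite rev_permE perm1.
Qed.

Lemma linext1 (r : 'S_2) : linext r 1.
Proof. by apply/linextP=> i j ij _; rewrite !perm1. Qed.

Lemma linext_tau : linext 1 swap2 = false.
Proof.
apply/negbTE/negP=> /linextP/(_ ord0 ord_max isT).
by rewrite tpermL tpermR !perm1 => /(_ isT).
Qed.

Lemma npictures_pp2 : npictures (pposet (1 : 'S_2)) (pposet (1 : 'S_2)) = 0%N.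
Proof.
apply/eqP/negPn/negP; rewrite -{2}(rev_permK 1%g) rev_perm2 => /npictures_rev_neq0.
case=> [/permP/(_ ord0)|lt]; first by rewrite tpermL perm1.
case: (linext_asc (linext1 swap2)) => [/permP/(_ ord0)|lt']; first by rewrite tpermL perm1.
by have := ltn_trans lt lt'; rewrite ltnn.
Qed.

Lemma sum_perm1 (V : nmodType) (F : 'S_1 -> V) : \sum_r F r = F 1%g.
Proof.
rewrite (bigD1 1%g) //= big1 ?addr0 // => r /eqP[]; apply/permP=> i.
by rewrite (ord1 (r i)) (ord1 i) perm1.
Qed.

Lemma cmul_dot_p : cmul (pcl (1 : 'S_1)) (pcl (1 : 'S_1)) = pcl swap2.
Proof.
have [r e] : exists r : 'S_2, cmul (pcl (1 : 'S_1)) (pcl (1 : 'S_1)) = pcl r.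
  by apply: planec_perm; [apply: planecM; apply: planec_pcl | rewrite crd_mul !crd_pcl].
case: (perm2P r) e => -> //; rewrite cmul_cls => /clsP/disoP[g [_ h _]].
have := h (inl ord0) (inr ord0); have := h (inr ord0) (inl ord0).
rewrite !le1_mul /= !le1_p !perm1 !andbb => /negbT; rewrite -ltnNge => /ltnW ->.
by [].
Qed.

Lemma cmul_dot_s : cmul (scl (1 : 'S_1)) (scl (1 : 'S_1)) = scl swap2.
Proof. exact/esym/sposet_cmul/esym/cmul_dot_p. Qed.

Section Converse.
Variables (K : fieldType).

Lemma inS_hspan n (a : HSPP K) : homog n (hval a) -> inS n (hval a).
Proof.
move=> /allP ha q nz; split; last by apply/eqP/ha; rewrite -mcoeff_neq0.
by case: a {ha} nz => a /= /hspanP; apply.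
Qed.

Lemma inS_sum_perm n (a : HDP K) : inS n a -> a = \sum_(r : 'S_n) a@_(scl r) *: << scl r >>.
Proof.
move=> /vecSK {1}<-; rewrite /ofS (reindex _ (onW_bij _ (enum_rank_bij 'S_n))) /=.
by apply: eq_bigr => r _; rewrite mxE enum_rankK.
Qed.

Lemma homogU n (a : HPP K) x : hval a = << x >> -> crd x = n -> homog n (hval a).
Proof.
move=> -> cx; apply/allP=> p; rewrite -mcoeff_neq0 mcoeffU.
by case: (x =P p) => [<-|]; rewrite ?cx ?eqxx.
Qed.

(** In degree two, let [ph] be the chain for the first order. The image of the antichain
    is the antichain, since the image of the point is the point up to sign; hence the
    image of [ph] is [a] times its special analogue plus [b] times the antichain.
    Comparing the pairings of [ph] with the antichain and with itself gives
    [a + 2 b = 1] and [a^2 + 2 a b + 2 b^2 = 0], that is [(1 - b)^2 = - b^2]. *)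
Lemma isometry_necessary (phi : {lrmorphism HPP K -> HSPP K}) :
  homogeneous phi -> isometric phi ->
  2%N \notin [pchar K] /\ exists i : K, i ^+ 2 = -1.
Proof.
move=> hom iso.
pose dot := hbase K plane_family (pcl (1 : 'S_1)).
pose ph := hbase K plane_family (pcl (1 : 'S_2)).
have vdot : hval dot = << pcl (1 : 'S_1) >> by apply/hbaseE/planec_pcl.
have vph : hval ph = << pcl (1 : 'S_2) >> by apply/hbaseE/planec_pcl.
have vpr : hval (dot * dot) = << pcl swap2 >>.
  by rewrite -cmul_dot_p -mul_basis -vdot.
have [c ec] : exists c, hval (phi dot) = c *: << scl (1 : 'S_1) >>.
  have /inS_hspan/inS_sum_perm -> := hom 1%N _ (homogU vdot (crd_pcl _)).
  by rewrite sum_perm1; eexists.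
have n1 : npic (pcl (1 : 'S_1)) (pcl (1 : 'S_1)) = 1%N.
  rewrite npic_cls -[RHS](npictures_rev (1 : 'S_1)); congr (npictures _ (pposet _)).
  by apply/permP=> i; rewrite [LHS]ord1 [RHS]ord1.
have n1' : npic (scl (1 : 'S_1)) (scl (1 : 'S_1)) = 1%N.
  by rewrite npic_cls npictures_special sum_perm1 invg1 linext_refl.
have c2 : c * c = 1.
  have := iso dot dot; rewrite ec vdot pairingZl pairingZr !pairing_basis n1 n1'.
  by rewrite mulr1.
have epr : hval (phi (dot * dot)) = << scl swap2 >>.
  rewrite rmorphM -cmul_dot_s -mul_basis.
  have -> : hval (phi dot * phi dot) = hval (phi dot) * hval (phi dot) by [].
  by rewrite ec -scalerAl malg_scaleAr scalerA c2 scale1r.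
have [a [b eh]] : exists a b, hval (phi ph) = a *: << scl (1 : 'S_2) >> + b *: << scl swap2 >>.
  have /inS_hspan/inS_sum_perm -> := hom 2%N _ (homogU vph (crd_pcl _)).
  by rewrite sum_perm2; do 2!eexists.
have tV : (swap2^-1 = swap2)%g by apply: tpermV.
have s11 : npic (scl (1 : 'S_2)) (scl (1 : 'S_2)) = 1%N.
  by rewrite npic_cls npictures_special sum_perm2 invg1 tV !linext1 linext_tau.
have s1t : npic (scl (1 : 'S_2)) (scl swap2) = 1%N.
  by rewrite npic_cls npictures_special sum_perm2 invg1 tV !linext1 linext_tau.
have stt : npic (scl swap2) (scl swap2) = 2%N.
  by rewrite npic_cls npictures_special sum_perm2 invg1 tV !linext1 linext_refl.
have pDl (u v w : HDP K) : pairing (u + v) w = pairing u w + pairing v w.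
  by rewrite -[u in LHS]scale1r pairing_linl [_ *: _]mul1r.
have pDr (u v w : HDP K) : pairing w (u + v) = pairing w u + pairing w v.
  by rewrite pairing_sym pDl !(pairing_sym w).
have eq1 : a + 2 * b = 1.
  have := iso ph (dot * dot); rewrite eh epr vph vpr pDl !pairingZl !pairing_basis s1t stt.
  rewrite npic_cls -rev_perm2 npictures_rev => h; rewrite -[RHS]mulr1n -h; ring.
have eq2 : a ^+ 2 + 2 * a * b + 2 * b ^+ 2 = 0.
  have := iso ph ph; rewrite eh vph !(pDl, pDr, pairingZl, pairingZr) !pairing_basis.
  rewrite [npic (scl swap2) (scl (1 : 'S_2))]npic_sym s11 s1t stt npic_cls npictures_pp2 => h.
  by rewrite -[RHS](mulr0n 1) -h; ring.
have ea : a = 1 - 2 * b by rewrite -[LHS](addrK (2 * b)) eq1.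
have eq3 : (1 - b) ^+ 2 = - b ^+ 2.
  have e0 : (1 - b) ^+ 2 + b ^+ 2 = 0 by rewrite -[RHS]eq2 ea; ring.
  by apply/eqP; rewrite -addr_eq0 e0.
split.
  rewrite !inE /=; apply/negP=> /eqP t0; move: eq2; rewrite ea t0.
  by move/eqP; rewrite !mul0r subr0 expr1n !addr0 oner_eq0.
have b0 : b != 0.
  by apply: contraTneq isT => b0; move/eqP: eq3; rewrite b0 subr0 expr1n expr0n oppr0 oner_eq0.
by exists ((1 - b) / b); rewrite expr_div_n eq3 mulNr divff // expf_neq0.
Qed.

End Converse.

Theorem theorem7p5 (K : fieldType) :
  (exists phi : {lrmorphism HPP K -> HSPP K},
     [/\ bijective phi, coalg_morph phi, homogeneous phi & isometric phi])
  <->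
  (2%N \notin [pchar K] /\ exists i : K, i ^+ 2 = -1).
Proof.
split=> [[phi [_ _ hom iso]]|[K2 [i i2]]]; first exact: isometry_necessary hom iso.
have nz2 : (2 : K) != 0 by move: K2; rewrite !inE.
have [f gf] := isometry_exists nz2 i2.
pose phi : {lrmorphism HPP K -> HSPP K} :=
  HB.pack (iso gf) (GRing.isLinear.Build _ _ _ _ _ (iso_linear gf))
    (GRing.isMonoidMorphism.Build _ _ _ (iso_monoid gf)).
exists phi; split.
- exact: iso_bij.
- exact: iso_coalg.
- exact: iso_homogeneous.
- exact: iso_isometric.
Qed.
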